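(* Let $P=\Bbbk[x_1,\ldots,x_n]$ be a quadratic Poisson algebra and let $H$ be a finite-dimensional Hopf algebra acting on $P$ (i.e. $P$ is an $H$-module Poisson algebra) while preserving degree. For $\lambda\in\Bbbk$ let $P_\lambda=\Bbbk\langle P_1\rangle/(\mathcal R_\lambda)$ be the graded associative algebra defined in the context. Then for any $\lambda\in\Bbbk$ there is a corresponding graded $H$-action on the associative graded algebra $P_\lambda$ (the one induced by the $H$-action on $P_1$). Moreover, if there is some $\lambda\in\Bbbk$ such that any graded finite-dimensional Hopf action on $P_\lambda$ must factor through a group algebra, then the $H$-action on $P$ also factors through a group algebra.
   Context: $\Bbbk$ is an algebraically closed field of characteristic zero; all algebras are $\Bbbk$-algebras. A Poisson algebra is a commutative algebra $A$ with a bilinear bracket $\{-,-\}$ such that $(A,\{-,-\})$ is a Lie algebra and each $\{a,-\}$ is a derivation of $A$. Sumless Sweedler notation is used: $\Delta(h)=h_1\otimes h_2$ (summation understood). An algebra $A$ is a (left) $H$-module algebra (i.e. $H$ acts on $A$) if it is a left $H$-module with $h\cdot 1_A=\epsilon(h)1_A$ and $h\cdot(ab)=(h_1\cdot a)(h_2\cdot b)$. A Poisson algebra $A$ is an $H$-module Poisson algebra if it is an $H$-module algebra and $h\cdot\{a,b\}=\{h_1\cdot a,h_2\cdot b\}$ for all $h\in H$, $a,b\in A$. An action of $H$ on $A$ factors through a group algebra if there is a Hopf ideal $I$ of $H$ with $I\cdot A=0$ and $H/I$ isomorphic, as a Hopf algebra, to a group algebra. A Hopf action on a graded algebra is graded (preserves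 degree) if each homogeneous component is a submodule. A ''graded finite-dimensional Hopf action'' is a graded action of a finite-dimensional Hopf algebra. A Poisson algebra $P=\Bbbk[x_1,\ldots,x_n]$ is quadratic if, with $\deg x_i=1$ and $P_k$ the space of homogeneous polynomials of degree $k$ (with zero), one has $\{x_i,x_j\}\in P_2$ for all $i,j$. Put $P_1=\Bbbk x_1\oplus\cdots\oplus\Bbbk x_n$. For $\lambda\in\Bbbk$ let $\sigma_\lambda=\mu+\lambda\{-,-\}:P\otimes P\to P$, where $\mu$ is the multiplication of $P$, and let $\mathcal R_\lambda=\ker\big(P_1\otimes P_1\hookrightarrow P\otimes P\xrightarrow{\sigma_\lambda}P\big)$. Then $P_\lambda=\Bbbk\langle P_1\rangle/(\mathcal R_\lambda)$, where $\Bbbk\langle P_1\rangle$ is the free (tensor) algebra on the vector space $P_1$ and $(\mathcal R_\lambda)$ is the two-sided ideal generated by $\mathcal R_\lambda$. *)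

(* Defs.v *)
From HB Require Import structures.
From mathcomp Require Import all_boot fingroup all_algebra falgebra.
From mathcomp Require Import generic_quotient boolp.
(* Without its notations: monalg's {mpoly _[_]} would clash with mpoly's. *)
From mathcomp Require Import -(notations) monalg.
From mathcomp Require Import mpoly.

Set Implicit Arguments.
Unset Strict Implicit.
Unset Printing Implicit Defensive.

Import GRing.Theory.
Local Open Scope ring_scope.
Local Open Scope quotient_scope.

Section Tensor.
Variable K : fieldType.

(* U (x) V for finite-dimensional U and V, in coordinates on the bases
   vbasis {:U} and vbasis {:V}: the (i, j) entry is the coefficient of
   e_i (x) e_j. *)
Definition tensor (U V : vectType K) : Type := 'M[K]_(\dim {:U}, \dim {:V}).
HB.instance Definition _ (U V : vectType K) :=
  Vector.copy (tensor U V) 'M[K]_(\dim {:U}, \dim {:V}).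

Definition tpure (U V : vectType K) (u : U) (v : V) : tensor U V :=
  \matrix_(i, j) (coord (vbasis {:U}) i u * coord (vbasis {:V}) j v).

(* For bilinear f, tlift f is the linear map U (x) V -> W with u (x) v |-> f u v
   (see tlift_pure). Thus tlift f (comul h) is the Sweedler expression
   f(h_1, h_2). *)
Definition tlift (U V : vectType K) (W : lmodType K) (f : U -> V -> W)
    (t : tensor U V) : W :=
  \sum_i \sum_j
    (t : 'M_(_, _)) i j *: f (vbasis {:U})`_i (vbasis {:V})`_j.

Definition bilin (U V W : lmodType K) (f : U -> V -> W) : Prop :=
  (forall v, linear (f^~ v)) /\ (forall u, linear (f u)).

Variables U V : vectType K.

Lemma tlift_linear (W : lmodType K) (f : U -> V -> W) : linear (tlift f).
Proof.
move=> c s t; rewrite /tlift scaler_sumr -big_split; apply: eq_bigr => i _ /=.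
rewrite scaler_sumr -big_split; apply: eq_bigr => j _ /=.
by rewrite !mxE scalerDl scalerA.
Qed.
HB.instance Definition _ (W : lmodType K) (f : U -> V -> W) :=
  GRing.isLinear.Build K (tensor U V) W _ (tlift f) (tlift_linear f).

Lemma bilin_suml (W : lmodType K) (f : U -> V -> W) v n (F : 'I_n -> U) :
  bilin f -> f (\sum_i F i) v = \sum_i f (F i) v.
Proof.
move=> [fl _].
pose g : {linear U -> W} := HB.pack (f^~ v) (GRing.isLinear.Build _ _ _ _ _ (fl v)).
exact: (linear_sum g).
Qed.

Lemma bilin_sumr (W : lmodType K) (f : U -> V -> W) u n (F : 'I_n -> V) :
  bilin f -> f u (\sum_i F i) = \sum_i f u (F i).
Proof.
move=> [_ fr].
pose g : {linear V -> W} := HB.pack (f u) (GRing.isLinear.Build _ _ _ _ _ (fr u)).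
exact: (linear_sum g).
Qed.

Lemma bilinZl (W : lmodType K) (f : U -> V -> W) c u v :
  bilin f -> f (c *: u) v = c *: f u v.
Proof.
move=> [fl _].
pose g : {linear U -> W} := HB.pack (f^~ v) (GRing.isLinear.Build _ _ _ _ _ (fl v)).
exact: (linearZ_LR g).
Qed.

Lemma bilinZr (W : lmodType K) (f : U -> V -> W) c u v :
  bilin f -> f u (c *: v) = c *: f u v.
Proof.
move=> [_ fr].
pose g : {linear V -> W} := HB.pack (f u) (GRing.isLinear.Build _ _ _ _ _ (fr u)).
exact: (linearZ_LR g).
Qed.

Lemma tlift_pure (W : lmodType K) (f : U -> V -> W) u v :
  bilin f -> tlift f (tpure u v) = f u v.
Proof.
move=> fb; rewrite [in RHS](coord_vbasis (memvf u)) [in RHS](coord_vbasis (memvf v)).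
rewrite (bilin_suml _ _ fb); apply: eq_bigr => i _.
rewrite (bilin_sumr _ _ fb); apply: eq_bigr => j _.
by rewrite (bilinZl _ _ _ fb) (bilinZr _ _ _ fb) scalerA mxE.
Qed.

Lemma tpure_bilin : bilin (@tpure U V).
Proof.
split=> [v c u1 u2|u c v1 v2]; apply/matrixP=> i j; rewrite !mxE linearP /=.
  by rewrite mulrDl mulrA.
by rewrite mulrDr mulrCA.
Qed.

Lemma tlift_tpure (t : tensor U V) : tlift (@tpure U V) t = t.
Proof.
have fr (X : vectType K) := basis_free (vbasisP {:X}).
apply/matrixP => a b.
have evL : linear (fun s : tensor U V => (s : 'M_(_, _)) a b : K^o).
  by move=> c r s; rewrite !mxE.
pose ev : {linear tensor U V -> K^o} :=
  HB.pack (fun s : tensor U V => (s : 'M_(_, _)) a b) (GRing.isLinear.Build _ _ _ _ _ evL).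
rewrite -[LHS]/(ev _) /tlift pair_bigA linear_sum (bigD1 (a, b)) // big1.
  by rewrite /= !mxE !coord_free ?fr // !eqxx !mulr1 addr0.
case=> i j; rewrite xpair_eqE negb_and => ij.
rewrite /= !mxE !coord_free ?fr //.
by case/orP: ij => /negPf ->; rewrite !(mulr0, mul0r).
Qed.

Lemma eq_tlift (W : lmodType K) (f g : U -> V -> W) t :
  (forall u v, f u v = g u v) -> tlift f t = tlift g t.
Proof.
by move=> fg; apply: eq_bigr => i _; apply: eq_bigr => j _; rewrite fg.
Qed.

Lemma linear_tlift (W X : lmodType K) (L : {linear W -> X}) (f : U -> V -> W) t :
  L (tlift f t) = tlift (fun u v => L (f u v)) t.
Proof.
rewrite linear_sum; apply: eq_bigr => i _; rewrite linear_sum.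
by apply: eq_bigr => j _; rewrite linearZ.
Qed.

(* The subspace A (x) B of U (x) V. *)
Definition tensv (A : {vspace U}) (B : {vspace V}) : {vspace tensor U V} :=
  <<[seq tpure u v | u <- vbasis A, v <- vbasis B]>>%VS.

End Tensor.

Definition tmap (K : fieldType) (U V U' V' : vectType K) (f : U -> U') (g : V -> V')
    (t : tensor U V) : tensor U' V' :=
  tlift (fun u v => tpure (f u) (g v)) t.

Section TensorMap.
Variables (K : fieldType) (U V U' V' : vectType K).
Implicit Types (f : U -> U') (g : V -> V').

Lemma tmap_linear f g : linear (tmap f g).
Proof. exact: tlift_linear. Qed.
HB.instance Definition _ f g :=
  GRing.isLinear.Build K (tensor U V) (tensor U' V') _ (tmap f g) (tmap_linear f g).

Lemma tmap_bilin f g : linear f -> linear g -> bilin (fun u v => tpure (f u) (g v)).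
Proof.
have [tl tr] := tpure_bilin U' V'.
by move=> fl gl; split=> [w c x y|w c x y] /=; rewrite (fl, gl) (tl, tr).
Qed.

Lemma tmap_pure f g u v : linear f -> linear g ->
  tmap f g (tpure u v) = tpure (f u) (g v).
Proof. by move=> fl gl; rewrite /tmap tlift_pure //; apply: tmap_bilin. Qed.

Lemma tlift_tmap (W : lmodType K) (F : U' -> V' -> W) f g t : bilin F ->
  tlift F (tmap f g t) = tlift (fun u v => F (f u) (g v)) t.
Proof.
by move=> Fb; rewrite /tmap (linear_tlift (tlift F)); apply: eq_tlift => u v /=; rewrite tlift_pure.
Qed.

End TensorMap.

Lemma bilin0l (K : fieldType) (U V W : lmodType K) (f : U -> V -> W) v :
  bilin f -> f 0 v = 0.
Proof.
by case=> fl _; have := fl v 1 0 0; rewrite !scale1r addr0 -{1}[f 0 v]addr0 => /addrI.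
Qed.

Lemma bilin0r (K : fieldType) (U V W : lmodType K) (f : U -> V -> W) u :
  bilin f -> f u 0 = 0.
Proof.
by case=> _ fr; have := fr u 1 0 0; rewrite !scale1r addr0 -{1}[f u 0]addr0 => /addrI.
Qed.

Lemma tlift_comb (K : fieldType) (U V : vectType K) (W : lmodType K) c
    (f g h : U -> V -> W) t : (forall u v, h u v = c *: f u v + g u v) ->
  tlift h t = c *: tlift f t + tlift g t.
Proof.
move=> hE; rewrite /tlift scaler_sumr -big_split; apply: eq_bigr => i _ /=.
rewrite scaler_sumr -big_split; apply: eq_bigr => j _ /=.
by rewrite hE scalerDr !scalerA [c * _]mulrC.
Qed.


(* Finite-dimensional Hopf algebras. Triple tensors are left-bracketed, so comulA
   compares h_11 (x) h_12 (x) h_2 with h_1 (x) h_21 (x) h_22. *)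
HB.mixin Record Falgebra_isHopf (K : fieldType) H of Falgebra K H := {
  comul : H -> tensor H H;
  counit : H -> K;
  antipode : H -> H;
  comul_linear : linear comul;
  counit_linear : scalar counit;
  antipode_linear : linear antipode;
  comulA : forall h,
    tlift (fun a b => tlift (fun a1 a2 => tpure (tpure a1 a2) b) (comul a)) (comul h)
    = tlift (fun a b => tlift (fun b1 b2 => tpure (tpure a b1) b2) (comul b)) (comul h);
  counitl : forall h, tlift (fun a b => counit a *: b) (comul h) = h;
  counitr : forall h, tlift (fun a b => counit b *: a) (comul h) = h;
  comul1 : comul 1 = tpure 1 1;
  comulM : forall g h, comul (g * h) =
    tlift (fun a b => tlift (fun c d => tpure (a * c) (b * d)) (comul h)) (comul g);
  counit1 : counit 1 = 1;
  counitM : forall g h, counit (g * h) = counit g * counit h;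
  antipodel : forall h, tlift (fun a b => antipode a * b) (comul h) = (counit h)%:A;
  antipoder : forall h, tlift (fun a b => a * antipode b) (comul h) = (counit h)%:A
}.

#[short(type="fhopfType")]
HB.structure Definition FHopf (K : fieldType) :=
  { H of Falgebra_isHopf K H & Falgebra K H }.

HB.instance Definition _ (K : fieldType) (H : fhopfType K) :=
  GRing.isLinear.Build K H (tensor H H) _ (@comul K H) comul_linear.
HB.instance Definition _ (K : fieldType) (H : fhopfType K) :=
  GRing.isLinear.Build K H K _ (@counit K H) counit_linear.
HB.instance Definition _ (K : fieldType) (H : fhopfType K) :=
  GRing.isLinear.Build K H H _ (@antipode K H) antipode_linear.

Definition hopf_iso (K : fieldType) (H H' : fhopfType K) : Prop :=
  exists f : H -> H',
    [/\ linear f, bijective f, monoid_morphism f,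
        forall h, comul (f h) = tmap f f (comul h)
      & (forall h, counit (f h) = counit h) /\
        (forall h, antipode (f h) = f (antipode h))].

(* Two-sided; closure under scalars follows from c *: x = c%:A * x. *)
Definition is_ideal (K : fieldType) (A : algType K) (J : A -> Prop) : Prop :=
  [/\ J 0, forall x y, J x -> J y -> J (x - y)
    & forall a x, J x -> J (a * x) /\ J (x * a)].

(* Proper, as algType requires 1 != 0. *)
Record ideal (K : fieldType) (A : algType K) := Ideal {
  ideal_pred :> {pred A};
  ideal_closed : is_ideal (fun x => x \in ideal_pred);
  ideal_proper : 1 \notin ideal_pred
}.

Section QuotAlg.
Variables (K : fieldType) (A : algType K) (I : ideal A).

Let I_zmod : zmod_closed I.
Proof. by case: (ideal_closed I) => I0 IB _; split=> // x y; apply: IB. Qed.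

HB.instance Definition _ := GRing.isZmodClosed.Build A (ideal_pred I) I_zmod.

Definition quot_alg : Type := Quotient.quot (ideal_pred I).
HB.instance Definition _ := GRing.Zmodule.on quot_alg.
HB.instance Definition _ : EqQuotient A (Quotient.equiv (ideal_pred I)) quot_alg :=
  EqQuotient.on quot_alg.

Definition qpi (x : A) : quot_alg := \pi_quot_alg x.

Lemma qpi_repr q : qpi (repr q) = q. Proof. exact: reprK. Qed.

Lemma qpi_eq x y : (qpi x == qpi y) = (x - y \in ideal_pred I).
Proof. by rewrite /qpi (@eqquotE A _ (Quotient.quot (ideal_pred I : {pred A})) x y). Qed.

Lemma qpiB : zmod_morphism qpi.
Proof. exact: (@pi_is_zmod_morphism A _ 0 (Quotient.quot (ideal_pred I))). Qed.
HB.instance Definition _ := GRing.isZmodMorphism.Build A quot_alg qpi qpiB.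

Lemma qpi_eq0 x : (qpi x == 0) = (x \in ideal_pred I).
Proof. by rewrite -(raddf0 qpi) qpi_eq subr0. Qed.

Lemma repr_qpi x : repr (qpi x) - x \in ideal_pred I.
Proof. by rewrite -qpi_eq qpi_repr. Qed.

Let idealMl a x : x \in ideal_pred I -> a * x \in ideal_pred I.
Proof. by case: (ideal_closed I) => _ _ IM xI; have [] := IM a x xI. Qed.
Let idealMr a x : x \in ideal_pred I -> x * a \in ideal_pred I.
Proof. by case: (ideal_closed I) => _ _ IM xI; have [] := IM a x xI. Qed.

Let idealD x y : x \in ideal_pred I -> y \in ideal_pred I -> x + y \in ideal_pred I.
Proof.
case: (ideal_closed I) => I0 IB _ xI yI.
rewrite -[y]opprK; apply: (IB) => //; rewrite -sub0r; exact: IB.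
Qed.

Lemma qpiD : {morph qpi : x y / x + y}.
Proof. exact: (raddfD qpi). Qed.

Definition qmul (p q : quot_alg) : quot_alg := qpi (repr p * repr q).
Definition qscale (c : K) (q : quot_alg) : quot_alg := qpi (c *: repr q).

Lemma qmulE x y : qmul (qpi x) (qpi y) = qpi (x * y).
Proof.
apply/eqP; rewrite qpi_eq -qpi_eq0.
have -> : repr (qpi x) * repr (qpi y) - x * y =
    (repr (qpi x) - x) * repr (qpi y) + x * (repr (qpi y) - y).
  by rewrite mulrBl mulrBr addrA subrK.
by rewrite qpi_eq0; apply: idealD; [apply: idealMr | apply: idealMl]; apply: repr_qpi.
Qed.

Lemma qscaleE c x : qscale c (qpi x) = qpi (c *: x).
Proof.
by apply/eqP; rewrite qpi_eq -scalerBr -mulr_algl idealMl ?repr_qpi.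
Qed.

Lemma quot_ind (P : quot_alg -> Prop) : (forall x, P (qpi x)) -> forall q, P q.
Proof. by move=> h q; rewrite -(qpi_repr q). Qed.

Lemma qmulA : associative qmul.
Proof.
by elim/quot_ind => x; elim/quot_ind => y; elim/quot_ind => z; rewrite !qmulE mulrA.
Qed.
Lemma qmul1 : left_id (qpi 1) qmul.
Proof. by elim/quot_ind => x; rewrite !qmulE mul1r. Qed.
Lemma qmulr1 : right_id (qpi 1) qmul.
Proof. by elim/quot_ind => x; rewrite !qmulE mulr1. Qed.
Lemma qmulDl : left_distributive qmul +%R.
Proof.
elim/quot_ind => x; elim/quot_ind => y; elim/quot_ind => z.
by rewrite -qpiD !qmulE mulrDl qpiD.
Qed.
Lemma qmulDr : right_distributive qmul +%R.
Proof.
elim/quot_ind => x; elim/quot_ind => y; elim/quot_ind => z.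
by rewrite -qpiD !qmulE mulrDr qpiD.
Qed.
Lemma qone_neq0 : qpi 1 != 0.
Proof. by rewrite qpi_eq0 ideal_proper. Qed.
HB.instance Definition _ := GRing.Zmodule_isNzRing.Build quot_alg
  qmulA qmul1 qmulr1 qmulDl qmulDr qone_neq0.

Lemma qscaleA a b v : qscale a (qscale b v) = qscale (a * b) v.
Proof. by elim/quot_ind: v => x; rewrite !qscaleE scalerA. Qed.
Lemma qscale1 : left_id 1 qscale.
Proof. by elim/quot_ind => x; rewrite !qscaleE scale1r. Qed.
Lemma qscaleDr : right_distributive qscale +%R.
Proof.
move=> a; elim/quot_ind => x; elim/quot_ind => y.
by rewrite -qpiD !qscaleE scalerDr qpiD.
Qed.
Lemma qscaleDl v : {morph qscale^~ v : a b / a + b}.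
Proof.
by move=> a b; elim/quot_ind: v => x; rewrite !qscaleE scalerDl qpiD.
Qed.
HB.instance Definition _ := GRing.Zmodule_isLmodule.Build K quot_alg
  qscaleA qscale1 qscaleDr qscaleDl.

Lemma qscaleAl (a : K) (u v : quot_alg) : a *: (u * v) = (a *: u) * v.
Proof.
elim/quot_ind: u => x; elim/quot_ind: v => y.
by rewrite -[LHS]/(qscale a (qmul _ _)) -[RHS]/(qmul (qscale _ _) _)
   !(qscaleE, qmulE) scalerAl.
Qed.
HB.instance Definition _ := GRing.Lmodule_isLalgebra.Build K quot_alg qscaleAl.
Lemma qscaleAr (a : K) (u v : quot_alg) : a *: (u * v) = u * (a *: v).
Proof.
elim/quot_ind: u => x; elim/quot_ind: v => y.
by rewrite -[LHS]/(qscale a (qmul _ _)) -[RHS]/(qmul _ (qscale _ _))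
   !(qscaleE, qmulE) scalerAr.
Qed.
HB.instance Definition _ := GRing.Lalgebra_isAlgebra.Build K quot_alg qscaleAr.

Lemma qpi_monoid_morphism : monoid_morphism qpi.
Proof. by split=> // x y; rewrite -[RHS]/(qmul _ _) qmulE. Qed.
HB.instance Definition _ := GRing.isMonoidMorphism.Build A quot_alg qpi qpi_monoid_morphism.
Lemma qpi_scalable : scalable qpi.
Proof. by move=> c x; rewrite -[RHS]/(qscale _ _) qscaleE. Qed.
HB.instance Definition _ := GRing.isScalable.Build K A quot_alg *:%R qpi qpi_scalable.

End QuotAlg.

Definition is_hopf_ideal (K : fieldType) (H : fhopfType K) (I : {vspace H}) : Prop :=
  [/\ forall a x, x \in I -> a * x \in I /\ x * a \in I,
      forall x, x \in I -> comul x \in (tensv I fullv + tensv fullv I)%VS,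
      forall x, x \in I -> counit x = 0
    & forall x, x \in I -> antipode x \in I].

Record hopf_ideal (K : fieldType) (H : fhopfType K) := HopfIdeal {
  hopf_ideal_vs :> {vspace H};
  hopf_idealP : is_hopf_ideal hopf_ideal_vs
}.

(* H/I with the Hopf structure for which the projection hpi is a Hopf map. *)
Section QuotHopf.
Variables (K : fieldType) (H : fhopfType K) (I : hopf_ideal H).

Fact hopf_ideal_closed : is_ideal (fun x : H => x \in [pred x | x \in hopf_ideal_vs I]).
Proof.
case: (hopf_idealP I) => IM _ _ _; split => [|x y|a x]; rewrite !inE ?mem0v //.
  exact: rpredB.
exact: IM.
Qed.

Fact hopf_ideal_proper : (1 : H) \notin [pred x | x \in hopf_ideal_vs I].
Proof.
rewrite inE; apply/negP; case: (hopf_idealP I) => _ _ I0 _ /I0 /eqP.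
by rewrite counit1 oner_eq0.
Qed.

Definition hopf_ideal_ideal : ideal H := Ideal hopf_ideal_closed hopf_ideal_proper.

Definition hquot : Type := quot_alg hopf_ideal_ideal.
HB.instance Definition _ := GRing.Algebra.on hquot.

Definition hpi (x : H) : hquot := qpi hopf_ideal_ideal x.
HB.instance Definition _ := GRing.LRMorphism.copy hpi (qpi hopf_ideal_ideal).

Let hpi_repr (q : hquot) : hpi (repr q) = q. Proof. exact: qpi_repr. Qed.
Let hpi_eq0 x : x \in hopf_ideal_vs I -> hpi x = 0.
Proof. by move=> xI; apply/eqP; rewrite [_ == _]qpi_eq0. Qed.
Let repr_hpi x : repr (hpi x) - x \in hopf_ideal_vs I.
Proof. exact: repr_qpi. Qed.
Let hquot_ind (P : hquot -> Prop) : (forall x, P (hpi x)) -> forall q, P q.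
Proof. by move=> h q; rewrite -(hpi_repr q). Qed.
Let hpi_linear : linear hpi. Proof. by move=> c x y; rewrite linearP. Qed.

Fact hquot_vect_iso : Vector.axiom (\dim (hopf_ideal_vs I)^C) hquot.
Proof.
set V := hopf_ideal_vs I; set W := (V^C)%VS; pose p := daddv_pi W V.
have dis : (W :&: V = 0)%VS by rewrite capvC capv_compl.
have dis' : (V :&: W = 0)%VS by rewrite capv_compl.
have addp x : p x + daddv_pi V W x = x.
  by rewrite daddv_pi_add // addvC addv_complf memvf.
have pV x : x \in V -> p x = 0.
  by move=> xV; apply: (@addIr _ x); rewrite -{2}(daddv_pi_id dis' xV) addp add0r.
have ppi x : p (repr (hpi x)) = p x.
  by apply/eqP; rewrite -subr_eq0 -linearB /= pV //; apply: repr_hpi.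
have pip x : hpi (p x) = hpi x.
  rewrite -{2}[x]addp linearD /= [hpi (daddv_pi V W x)]hpi_eq0 ?addr0 //.
  exact: memv_pi.
exists (fun q : hquot => \row_i coord (vbasis W) i (p (repr q))).
  move=> c; elim/hquot_ind => x; elim/hquot_ind => y; apply/rowP => i.
  by rewrite -hpi_linear !mxE !ppi !linearP.
exists (fun r : 'rV_(\dim W) => hpi (\sum_i r 0 i *: (vbasis W)`_i)).
  elim/hquot_ind => x; rewrite -[RHS]pip; congr (hpi _).
  rewrite [RHS](coord_vbasis (memv_pi W V x)).
  by apply: eq_bigr => i _; rewrite mxE ppi.
move=> r; apply/rowP => i; rewrite mxE ppi [p _]daddv_pi_id //.
  by rewrite coord_sum_free ?(basis_free (vbasisP W)).
by apply: rpred_sum => j _; rewrite rpredZ ?vbasis_mem ?memt_nth.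
Qed.

HB.instance Definition _ := Lmodule_hasFinDim.Build K hquot hquot_vect_iso.
HB.instance Definition _ := Algebra_isFalgebra.Build K hquot.

Definition qcomul (q : hquot) : tensor hquot hquot := tmap hpi hpi (comul (repr q)).
Definition qcounit (q : hquot) : K := counit (repr q).
Definition qantipode (q : hquot) : hquot := hpi (antipode (repr q)).

Let tmap_tensv (A B : {vspace H}) t :
    (forall u v, u \in A -> v \in B -> tpure (hpi u) (hpi v) = 0) ->
  t \in tensv A B -> tmap hpi hpi t = 0.
Proof.
move=> h; set L := linfun (tmap hpi hpi : tensor H H -> tensor hquot hquot).
suff sub : (tensv A B <= lker L)%VS.
  by move=> /(subvP sub); rewrite memv_ker /L lfunE => /eqP.
apply/span_subvP => _ /allpairsP[[u v] /= [uA vB ->]].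
by rewrite memv_ker /L lfunE /= tmap_pure ?h ?vbasis_mem //.
Qed.

Let qcomulE x : qcomul (hpi x) = tmap hpi hpi (comul x).
Proof.
apply/eqP; rewrite -subr_eq0 -linearB -linearB /=; apply/eqP.
case: (hopf_idealP I) => _ ID _ _; have /memv_addP[s sI [t tI ->]] := ID _ (repr_hpi x).
rewrite linearD /= (tmap_tensv _ sI) ?(tmap_tensv _ tI) ?addr0 // => u v uA vB.
  by rewrite (hpi_eq0 vB) bilin0r //; apply: tpure_bilin.
by rewrite (hpi_eq0 uA) (bilin0l (f := @tpure _ _ _)) //; apply: tpure_bilin.
Qed.

Let qcounitE x : qcounit (hpi x) = counit x.
Proof.
apply/eqP; rewrite -subr_eq0 -linearB /=; apply/eqP.
by case: (hopf_idealP I) => _ _ I0 _; apply: I0; apply: repr_hpi.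
Qed.

Let qantipodeE x : qantipode (hpi x) = hpi (antipode x).
Proof.
apply/eqP; rewrite -subr_eq0 -linearB /=; apply/eqP; rewrite -linearB /=.
by case: (hopf_idealP I) => _ _ _ IS; apply/hpi_eq0/IS/repr_hpi.
Qed.

Let tpl (U V : vectType K) v : linear ((@tpure K U V)^~ v).
Proof. exact: (tpure_bilin U V).1. Qed.
Let tpr (U V : vectType K) u : linear (@tpure K U V u).
Proof. exact: (tpure_bilin U V).2. Qed.

Lemma qcomul_linear : linear qcomul.
Proof.
move=> c; elim/hquot_ind => x; elim/hquot_ind => y.
by rewrite -hpi_linear !qcomulE comul_linear linearP.
Qed.

Lemma qcounit_linear : scalar qcounit.
Proof.
move=> c; elim/hquot_ind => x; elim/hquot_ind => y.
by rewrite -hpi_linear !qcounitE counit_linear.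
Qed.

Lemma qantipode_linear : linear qantipode.
Proof.
move=> c; elim/hquot_ind => x; elim/hquot_ind => y.
by rewrite -hpi_linear !qantipodeE antipode_linear hpi_linear.
Qed.

Let hpi3l : linear (tmap (tmap hpi hpi) hpi). Proof. exact: tmap_linear. Qed.

Lemma qcomulA q :
  tlift (fun a b => tlift (fun a1 a2 => tpure (tpure a1 a2) b) (qcomul a)) (qcomul q)
  = tlift (fun a b => tlift (fun b1 b2 => tpure (tpure a b1) b2) (qcomul b)) (qcomul q).
Proof.
elim/hquot_ind: q => x; rewrite qcomulE !tlift_tmap; last 2 first.
- split=> [b c p q|a c p q] /=; first by apply: tlift_comb => u v; rewrite !tpl.
  by rewrite qcomul_linear tlift_linear.
- split=> [b c p q|a c p q] /=; last by apply: tlift_comb => u v; rewrite tpr.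
  by rewrite qcomul_linear tlift_linear.
transitivity (tmap (tmap hpi hpi) hpi (tlift (fun a b : H =>
    tlift (fun a1 a2 => tpure (tpure a1 a2) b) (comul a)) (comul x))).
  rewrite (linear_tlift (tmap (tmap hpi hpi) hpi)); apply: eq_tlift => a b /=.
  rewrite (linear_tlift (tmap (tmap hpi hpi) hpi)) qcomulE tlift_tmap.
    by apply: eq_tlift => u v; rewrite /= !tmap_pure //; apply: tmap_linear.
  by split=> [? c p q|? c p q] /=; rewrite ?tpl ?tpr ?tpl.
rewrite comulA (linear_tlift (tmap (tmap hpi hpi) hpi)); apply: eq_tlift => a b /=.
rewrite (linear_tlift (tmap (tmap hpi hpi) hpi)) qcomulE tlift_tmap.
  by apply: eq_tlift => u v; rewrite /= !tmap_pure //; apply: tmap_linear.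
by split=> [? c p q|? c p q] /=; rewrite ?tpr ?tpl.
Qed.

Lemma qcounitl q : tlift (fun a b => qcounit a *: b) (qcomul q) = q.
Proof.
elim/hquot_ind: q => x; rewrite qcomulE tlift_tmap; last first.
  split=> [b c p q|a c p q] /=; first by rewrite qcounit_linear scalerDl scalerA.
  by rewrite scalerDr !scalerA mulrC.
rewrite -[in RHS](counitl x) (linear_tlift hpi); apply: eq_tlift => a b /=.
by rewrite qcounitE linearZ.
Qed.

Lemma qcounitr q : tlift (fun a b => qcounit b *: a) (qcomul q) = q.
Proof.
elim/hquot_ind: q => x; rewrite qcomulE tlift_tmap; last first.
  split=> [b c p q|a c p q] /=; last by rewrite qcounit_linear scalerDl scalerA.
  by rewrite scalerDr !scalerA mulrC.
rewrite -[in RHS](counitr x) (linear_tlift hpi); apply: eq_tlift => a b /=.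
by rewrite qcounitE linearZ.
Qed.

Lemma qcomul1 : qcomul 1 = tpure 1 1.
Proof. by rewrite -(rmorph1 hpi) qcomulE comul1 tmap_pure. Qed.

Lemma qcomulM p q : qcomul (p * q) =
  tlift (fun a b => tlift (fun c d => tpure (a * c) (b * d)) (qcomul q)) (qcomul p).
Proof.
elim/hquot_ind: p => x; elim/hquot_ind: q => y.
rewrite -(rmorphM hpi) !qcomulE comulM tlift_tmap; last first.
  split=> [b c p q|a c p q] /=; apply: tlift_comb => u v.
    by rewrite mulrDl -scalerAl tpl.
  by rewrite mulrDl -scalerAl tpr.
rewrite (linear_tlift (tmap hpi hpi)); apply: eq_tlift => a b /=.
rewrite (linear_tlift (tmap hpi hpi)) tlift_tmap.
  by apply: eq_tlift => c d /=; rewrite tmap_pure // !rmorphM.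
split=> [? c p q|? c p q] /=; rewrite mulrDr -scalerAr; first by rewrite tpl.
by rewrite tpr.
Qed.

Lemma qcounit1 : qcounit 1 = 1.
Proof. by rewrite -(rmorph1 hpi) qcounitE counit1. Qed.

Lemma qcounitM p q : qcounit (p * q) = qcounit p * qcounit q.
Proof.
elim/hquot_ind: p => x; elim/hquot_ind: q => y.
by rewrite -(rmorphM hpi) !qcounitE counitM.
Qed.

Lemma qantipodel q : tlift (fun a b => qantipode a * b) (qcomul q) = (qcounit q)%:A.
Proof.
elim/hquot_ind: q => x; rewrite qcomulE tlift_tmap; last first.
  split=> [b c p q|a c p q] /=; first by rewrite qantipode_linear mulrDl scalerAl.
  by rewrite mulrDr scalerAr.
rewrite qcounitE -(rmorph1 hpi) -linearZ -antipodel (linear_tlift hpi).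
by apply: eq_tlift => a b /=; rewrite qantipodeE rmorphM.
Qed.

Lemma qantipoder q : tlift (fun a b => a * qantipode b) (qcomul q) = (qcounit q)%:A.
Proof.
elim/hquot_ind: q => x; rewrite qcomulE tlift_tmap; last first.
  split=> [b c p q|a c p q] /=; last by rewrite qantipode_linear mulrDr scalerAr.
  by rewrite mulrDl scalerAl.
rewrite qcounitE -(rmorph1 hpi) -linearZ -antipoder (linear_tlift hpi).
by apply: eq_tlift => a b /=; rewrite qantipodeE rmorphM.
Qed.

HB.instance Definition _ := Falgebra_isHopf.Build K hquot
  qcomul_linear qcounit_linear qantipode_linear qcomulA qcounitl qcounitr
  qcomul1 qcomulM qcounit1 qcounitM qantipodel qantipoder.

Lemma comul_hpi x : comul (hpi x) = tmap hpi hpi (comul x).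
Proof. exact: qcomulE. Qed.
Lemma counit_hpi x : counit (hpi x) = counit x.
Proof. exact: qcounitE. Qed.
Lemma antipode_hpi x : antipode (hpi x) = hpi (antipode x).
Proof. exact: qantipodeE. Qed.

End QuotHopf.

Section GroupAlgebra.
Variables (K : fieldType) (G : finGroupType).

Definition group_alg : Type := {ffun G -> K^o}.
HB.instance Definition _ := Vector.copy group_alg {ffun G -> K^o}.

Definition gdelta (g : G) : group_alg := [ffun x => (x == g)%:R].

Definition glift (W : lmodType K) (F : G -> W) (f : group_alg) : W :=
  \sum_g (f : {ffun _}) g *: F g.

Lemma glift_linear (W : lmodType K) (F : G -> W) : linear (glift F).
Proof.
move=> c f h; rewrite /glift scaler_sumr -big_split; apply: eq_bigr => g _ /=.
by rewrite !ffunE scalerDl scalerA.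
Qed.
HB.instance Definition _ (W : lmodType K) (F : G -> W) :=
  GRing.isLinear.Build K group_alg W _ (glift F) (glift_linear F).

Lemma glift_delta (W : lmodType K) (F : G -> W) g : glift F (gdelta g) = F g.
Proof.
rewrite /glift (bigD1 g) //= ffunE eqxx scale1r big1 ?addr0 // => h /negPf hg.
by rewrite ffunE hg scale0r.
Qed.

Lemma glift_id f : glift gdelta f = f.
Proof.
apply/ffunP => x; rewrite sum_ffunE (bigD1 x) //= !ffunE eqxx big1 ?addr0.
  exact: mulr1.
by move=> h /negPf hx; rewrite !ffunE eq_sym hx; apply: mulr0.
Qed.

Lemma galg_ext (W : lmodType K) (L1 L2 : group_alg -> W) :
  linear L1 -> linear L2 -> (forall g, L1 (gdelta g) = L2 (gdelta g)) -> L1 =1 L2.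
Proof.
move=> l1 l2 eq12 f.
pose M1 : {linear group_alg -> W} := HB.pack L1 (GRing.isLinear.Build _ _ _ _ _ l1).
pose M2 : {linear group_alg -> W} := HB.pack L2 (GRing.isLinear.Build _ _ _ _ _ l2).
rewrite -[L1]/(M1 : _ -> _) -[L2]/(M2 : _ -> _) -(glift_id f) !linear_sum.
by apply: eq_bigr => g _; rewrite !linearZ /= eq12.
Qed.

Lemma eq_glift (W : lmodType K) (F F' : G -> W) f : F =1 F' -> glift F f = glift F' f.
Proof. by move=> eqF; apply: eq_bigr => g _; rewrite eqF. Qed.

Lemma glift_comb (W : lmodType K) c (F F' F'' : G -> W) f :
  (forall g, F'' g = c *: F g + F' g) -> glift F'' f = c *: glift F f + glift F' f.
Proof.
move=> eqF; rewrite /glift scaler_sumr -big_split; apply: eq_bigr => g _ /=.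
by rewrite eqF scalerDr !scalerA [c * _]mulrC.
Qed.

Definition gmul (f h : group_alg) : group_alg :=
  glift (fun x => glift (fun y => gdelta (x * y)%g) h) f.

Lemma gmull h : linear (gmul^~ h).
Proof. by move=> c f f'; rewrite /gmul glift_linear. Qed.
Lemma gmulr f : linear (gmul f).
Proof. by move=> c h h'; rewrite /gmul; apply: glift_comb => g; rewrite glift_linear. Qed.
Lemma gmul_delta x y : gmul (gdelta x) (gdelta y) = gdelta (x * y)%g.
Proof. by rewrite /gmul !glift_delta. Qed.

Lemma gmulA : associative gmul.
Proof.
move=> f h k; move: f; apply: galg_ext => [c f f'|c f f'|x]; rewrite ?gmull //.
move: h; apply: galg_ext => [c f f'|c f f'|y]; rewrite ?(gmulr, gmull) //.
move: k; apply: galg_ext => [c f f'|c f f'|z]; rewrite ?(gmulr, gmull) //.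
by rewrite !gmul_delta mulgA.
Qed.

Lemma gmul1 : left_id (gdelta 1%g) gmul.
Proof.
apply: galg_ext => [c f f'|//|x]; first by rewrite gmulr.
by rewrite gmul_delta mul1g.
Qed.
Lemma gmulr1 : right_id (gdelta 1%g) gmul.
Proof.
apply: galg_ext => [c f f'|//|x]; first by rewrite gmull.
by rewrite gmul_delta mulg1.
Qed.
Lemma gmulDl : left_distributive gmul +%R.
Proof. by move=> f g h; have := gmull h 1 f g; rewrite !scale1r. Qed.
Lemma gmulDr : right_distributive gmul +%R.
Proof. by move=> h f g; have := gmulr h 1 f g; rewrite !scale1r. Qed.
Lemma gone_neq0 : gdelta 1%g != 0.
Proof.
apply/eqP => /ffunP /(_ 1%g); rewrite !ffunE eqxx => /eqP.
by rewrite oner_eq0.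
Qed.
HB.instance Definition _ := GRing.Zmodule_isNzRing.Build group_alg
  gmulA gmul1 gmulr1 gmulDl gmulDr gone_neq0.

Lemma gscaleAl (a : K) (f h : group_alg) : a *: (f * h) = (a *: f) * h.
Proof.
have := gmull h a f 0; rewrite /= addr0 => E; rewrite -[RHS]/(gmul (a *: f) h) E.
by rewrite -[gmul 0 h]/(0 * h) mul0r addr0.
Qed.
HB.instance Definition _ := GRing.Lmodule_isLalgebra.Build K group_alg gscaleAl.
Lemma gscaleAr (a : K) (f h : group_alg) : a *: (f * h) = f * (a *: h).
Proof.
have := gmulr f a h 0; rewrite /= addr0 => E; rewrite -[RHS]/(gmul f (a *: h)) E.
by rewrite -[gmul f 0]/(f * 0) mulr0 addr0.
Qed.
HB.instance Definition _ := GRing.Lalgebra_isAlgebra.Build K group_alg gscaleAr.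
HB.instance Definition _ := Algebra_isFalgebra.Build K group_alg.

Lemma gdeltaM x y : gdelta x * gdelta y = gdelta (x * y)%g.
Proof. exact: gmul_delta. Qed.

Definition gcomul : group_alg -> tensor group_alg group_alg :=
  glift (fun g => tpure (gdelta g) (gdelta g)).
Definition gcounit : group_alg -> K := glift (fun _ => 1 : K^o).
Definition gantipode : group_alg -> group_alg := glift (fun g => gdelta g^-1%g).

Lemma gcomul_linear : linear gcomul. Proof. exact: glift_linear. Qed.
Lemma gcounit_linear : scalar gcounit.
Proof. by move=> c f h; rewrite /gcounit glift_linear. Qed.
Lemma gantipode_linear : linear gantipode. Proof. exact: glift_linear. Qed.

Let tp := tpure_bilin group_alg group_alg.
Let gcomulE x : gcomul (gdelta x) = tpure (gdelta x) (gdelta x).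
Proof. exact: glift_delta. Qed.
Let gcounitE x : gcounit (gdelta x) = 1.
Proof. by rewrite /gcounit glift_delta. Qed.
Let gantipodeE x : gantipode (gdelta x) = gdelta x^-1%g. Proof. exact: glift_delta. Qed.
Let tpl (U V : vectType K) v : linear ((@tpure K U V)^~ v).
Proof. exact: (tpure_bilin U V).1. Qed.
Let tpr (U V : vectType K) u : linear (@tpure K U V u).
Proof. exact: (tpure_bilin U V).2. Qed.

Lemma gcomulA h :
  tlift (fun a b => tlift (fun a1 a2 => tpure (tpure a1 a2) b) (gcomul a)) (gcomul h)
  = tlift (fun a b => tlift (fun b1 b2 => tpure (tpure a b1) b2) (gcomul b)) (gcomul h).
Proof.
move: h; apply: galg_ext => [c f f'|c f f'|x]; rewrite ?gcomul_linear ?tlift_linear //.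
rewrite gcomulE tlift_pure; last first.
  split=> [b c p q|a c p q] /=; last by apply: tlift_comb => u v; rewrite tpr.
  by rewrite gcomul_linear tlift_linear.
rewrite gcomulE tlift_pure; last first.
  by split=> [? c p q|? c p q] /=; rewrite ?tpl ?tpr ?tpl.
rewrite tlift_pure; last first.
  split=> [b c p q|a c p q] /=; first by apply: tlift_comb => u v; rewrite !tpl.
  by rewrite gcomul_linear tlift_linear.
rewrite gcomulE tlift_pure //.
by split=> [? c p q|? c p q] /=; rewrite ?tpr ?tpl.
Qed.

Lemma gcounitl h : tlift (fun a b => gcounit a *: b) (gcomul h) = h.
Proof.
move: h; apply: galg_ext => [c f f'|//|x]; rewrite ?gcomul_linear ?tlift_linear //.
rewrite gcomulE tlift_pure ?gcounitE ?scale1r //.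
split=> [b c p q|a c p q] /=; first by rewrite gcounit_linear scalerDl scalerA.
by rewrite scalerDr !scalerA mulrC.
Qed.

Lemma gcounitr h : tlift (fun a b => gcounit b *: a) (gcomul h) = h.
Proof.
move: h; apply: galg_ext => [c f f'|//|x]; rewrite ?gcomul_linear ?tlift_linear //.
rewrite gcomulE tlift_pure ?gcounitE ?scale1r //.
split=> [b c p q|a c p q] /=; last by rewrite gcounit_linear scalerDl scalerA.
by rewrite scalerDr !scalerA mulrC.
Qed.

Lemma gcomul1 : gcomul 1 = tpure 1 1. Proof. exact: gcomulE. Qed.

Lemma gcomulM f h : gcomul (f * h) =
  tlift (fun a b => tlift (fun c d => tpure (a * c) (b * d)) (gcomul h)) (gcomul f).
Proof.
move: f; apply: galg_ext => [c f f'|c f f'|x].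
- by rewrite mulrDl -scalerAl gcomul_linear.
- by rewrite gcomul_linear tlift_linear.
rewrite gcomulE tlift_pure; last first.
  split=> [b c p q|a c p q] /=; apply: tlift_comb => u v.
    by rewrite mulrDl -scalerAl tpl.
  by rewrite mulrDl -scalerAl tpr.
move: h; apply: galg_ext => [c f f'|c f f'|y].
- by rewrite mulrDr -scalerAr gcomul_linear.
- by rewrite gcomul_linear tlift_linear.
rewrite gdeltaM !gcomulE tlift_pure ?gdeltaM //.
split=> [? c p q|? c p q] /=; rewrite mulrDr -scalerAr; first by rewrite tpl.
by rewrite tpr.
Qed.

Lemma gcounit1 : gcounit 1 = 1. Proof. exact: gcounitE. Qed.

Lemma gcounitM f h : gcounit (f * h) = gcounit f * gcounit h.
Proof.
move: f; apply: (@galg_ext K^o) => [c f f'|c f f'|x].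
- by rewrite mulrDl -scalerAl gcounit_linear.
- by rewrite gcounit_linear mulrDl -mulrA.
move: h; apply: (@galg_ext K^o) => [c f f'|c f f'|y].
- by rewrite mulrDr -scalerAr gcounit_linear.
- by rewrite gcounit_linear mulrDr mulrCA.
by rewrite gdeltaM !gcounitE mulr1.
Qed.

Let unit_lin : linear (fun h : group_alg => (gcounit h)%:A : group_alg).
Proof. by move=> c f f'; rewrite gcounit_linear scalerDl scalerA. Qed.

Lemma gantipodel h : tlift (fun a b => gantipode a * b) (gcomul h) = (gcounit h)%:A.
Proof.
move: h; apply: (galg_ext _ unit_lin) => [c f f'|x].
  by rewrite gcomul_linear tlift_linear.
rewrite gcomulE tlift_pure ?gantipodeE ?gdeltaM ?mulVg ?gcounitE ?scale1r //.
split=> [b c p q|a c p q] /=; first by rewrite gantipode_linear mulrDl scalerAl.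
by rewrite mulrDr scalerAr.
Qed.

Lemma gantipoder h : tlift (fun a b => a * gantipode b) (gcomul h) = (gcounit h)%:A.
Proof.
move: h; apply: (galg_ext _ unit_lin) => [c f f'|x].
  by rewrite gcomul_linear tlift_linear.
rewrite gcomulE tlift_pure ?gantipodeE ?gdeltaM ?mulgV ?gcounitE ?scale1r //.
split=> [b c p q|a c p q] /=; last by rewrite gantipode_linear mulrDr scalerAr.
by rewrite mulrDl scalerAl.
Qed.

HB.instance Definition _ := Falgebra_isHopf.Build K group_alg
  gcomul_linear gcounit_linear gantipode_linear gcomulA gcounitl gcounitr
  gcomul1 gcomulM gcounit1 gcounitM gantipodel gantipoder.

End GroupAlgebra.

Definition hopf_action (K : fieldType) (H : fhopfType K) (A : algType K)
    (act : H -> A -> A) : Prop :=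
  [/\ bilin act,
      (forall a, act 1 a = a) /\ (forall g h a, act (g * h) a = act g (act h a)),
      forall h, act h 1 = (counit h)%:A
    & forall h a b,
        act h (a * b) = tlift (fun h1 h2 => act h1 a * act h2 b) (comul h)].

(* comp d is the degree d homogeneous component of A. *)
Definition graded_action (K : fieldType) (H : fhopfType K) (A : algType K)
    (comp : nat -> A -> Prop) (act : H -> A -> A) : Prop :=
  forall d h a, comp d a -> comp d (act h a).

(* H/I is finite-dimensional, so a group algebra isomorphic to it is that of a
   finite group. *)
Definition factors_through_group_algebra (K : fieldType) (H : fhopfType K)
    (A : algType K) (act : H -> A -> A) : Prop :=
  exists2 I : hopf_ideal H,
    forall h a, h \in hopf_ideal_vs I -> act h a = 0
  & exists G : finGroupType, hopf_iso (hquot I) (group_alg K G).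

Definition poisson_bracket (K : fieldType) (A : comAlgType K) (br : A -> A -> A) : Prop :=
  [/\ bilin br, forall a, br a a = 0,
      forall a b c, br a (br b c) + br b (br c a) + br c (br a b) = 0
    & forall a b c, br a (b * c) = br a b * c + b * br a c].

Definition poisson_hopf_action (K : fieldType) (H : fhopfType K) (A : comAlgType K)
    (br : A -> A -> A) (act : H -> A -> A) : Prop :=
  hopf_action act /\
  forall h a b,
    act h (br a b) = tlift (fun h1 h2 => br (act h1 a) (act h2 b)) (comul h).

Section Generated.
Variables (K : fieldType) (A : algType K) (S : A -> Prop).

(* The two-sided ideal generated by S. *)
Definition ideal_gen (x : A) : Prop :=
  forall J : A -> Prop, is_ideal J -> (forall s, S s -> J s) -> J x.

Lemma ideal_gen_closed : is_ideal ideal_gen.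
Proof.
split=> [J [] //|x y xI yI J JI SJ|a x xI].
  by case: (JI) => _ JB _; apply: JB; [apply: xI | apply: yI].
by split=> J JI SJ; case: (JI) => _ _ JM; have [] := JM a x (xI J JI SJ).
Qed.

Definition ideal_gen_pred : {pred A} := [pred x | `[< ideal_gen x >]].

Fact ideal_gen_pred_closed : is_ideal (fun x => x \in ideal_gen_pred).
Proof.
case: ideal_gen_closed => I0 IB IM; split => [|x y xI yI|a x xI].
- exact/asboolP.
- by apply/asboolP; apply: IB; apply: asboolW.
- by have [? ?] := IM a x (asboolW xI); split; exact/asboolP.
Qed.

End Generated.

Lemma malg_scaleAr (K : comNzRingType) (M : monomType) (c : K) (f g : malg M K) :
  c *: (f * g) = f * (c *: g).
Proof.
have sub : finmap.fsubset (monalg.msupp (c *: g)) (monalg.msupp g).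
  apply/finmap.fsubsetP => w; rewrite -!monalg.mcoeff_neq0 monalg.mcoeffZ.
  by apply: contraNneq => ->; rewrite mulr0.
apply/monalg.malgP => w; rewrite monalg.mcoeffZ monalg.mcoeffMl.
rewrite (monalg.mcoeffMlw _ (finmap.fsubset_refl _) sub) mulr_sumr.
apply: eq_bigr => u _; rewrite mulr_sumr; apply: eq_bigr => v _.
by rewrite monalg.mcoeffZ (mulrCA (monalg.mcoeff u f)) mulrnAr.
Qed.

Section FreeAlgebra.
Variables (K : fieldType) (n : nat).

(* The free algebra on 'I_n: words in 'I_n as a basis. With the basis x_i of
   P_1 it is the tensor algebra of P_1. *)
Definition freealg : Type := monalg.malg (monalg.fmonom 'I_n) K.
HB.instance Definition _ := GRing.Lalgebra.copy freealg (monalg.malg (monalg.fmonom 'I_n) K).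

Lemma freealg_scaleAr (c : K) (f g : freealg) : c *: (f * g) = f * (c *: g).
Proof. exact: malg_scaleAr. Qed.
HB.instance Definition _ := GRing.Lalgebra_isAlgebra.Build K freealg freealg_scaleAr.

Definition fvar (i : 'I_n) : freealg := monalg.mkmalgU (monalg.fmu i) 1.

Definition fhomog (d : nat) (f : freealg) : Prop :=
  forall w, monalg.mcoeff w f != 0 -> monalg.fdeg w = d.

Definition fconst (f : freealg) : K := monalg.mcoeff mone f.
Lemma fconst_linear : scalar fconst.
Proof. by move=> c f g; rewrite /fconst monalg.mcoeffD monalg.mcoeffZ. Qed.
Lemma fconstM f g : fconst (f * g) = fconst f * fconst g.
Proof. exact: (monalg.mcoeff1g_is_multiplicative _ _).1. Qed.
Lemma fconst1 : fconst 1 = 1.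
Proof. exact: (monalg.mcoeff1g_is_multiplicative _ _).2. Qed.

Lemma fconst_var i : fconst (fvar i) = 0.
Proof. by rewrite /fconst monalg.mcoeffU monalg.fm1_eq1. Qed.
Lemma fconst0 : fconst 0 = 0.
Proof. exact: monalg.mcoeff0. Qed.

End FreeAlgebra.

Section QuadraticDeformation.
Variables (K : fieldType) (n : nat).
Local Notation P := {mpoly K[n]}.
Variable br : P -> P -> P.

Definition quadratic : Prop := forall i j : 'I_n, br 'X_i 'X_j \is 2.-homog.

(* P_1 = K x_1 + ... + K x_n is represented by coordinate vectors; P1_poly and
   P1_free embed it in P and in the free algebra. *)
Definition P1_poly (v : 'rV[K]_n) : P := \sum_i v 0 i *: 'X_i.
Definition P1_free (v : 'rV[K]_n) : freealg K n := \sum_i v 0 i *: fvar K i.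

Variable lambda : K.

Definition sigma (p q : P) : P := p * q + lambda *: br p q.

(* R_lambda, as a subset of the degree 2 part of the free algebra. *)
Definition relation (r : freealg K n) : Prop :=
  exists2 t : tensor 'rV[K]_n 'rV[K]_n,
    tlift (fun u v => sigma (P1_poly u) (P1_poly v)) t = 0
  & r = tlift (fun u v => P1_free u * P1_free v) t.

Lemma fconst_P1_free v : fconst (P1_free v) = 0.
Proof.
have fL : linear (@fconst K n : _ -> K^o) by exact: fconst_linear.
pose L : {linear freealg K n -> K^o} := HB.pack (@fconst K n : _ -> K^o)
  (GRing.isLinear.Build _ _ _ _ _ fL).
rewrite -[LHS]/(L _) linear_sum big1 // => i _; rewrite linearZ /=.
by rewrite fconst_var scaler0.
Qed.

Fact relation_ideal_proper : 1 \notin ideal_gen_pred relation.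
Proof.
apply/asboolP => /(_ (fun x => fconst x = 0)) /=.
rewrite fconst1 => h; have /eqP := oner_neq0 K; apply; apply: h.
  split=> [|x y x0 y0|a x x0]; [exact: fconst0| |].
    by rewrite -scaleN1r addrC fconst_linear x0 y0 mulr0 addr0.
  by split; rewrite fconstM x0 (mulr0, mul0r).
move=> _ [t _ ->].
have fL : linear (@fconst K n : _ -> K^o) by exact: fconst_linear.
pose L : {linear freealg K n -> K^o} := HB.pack (@fconst K n : _ -> K^o)
  (GRing.isLinear.Build _ _ _ _ _ fL).
rewrite -[LHS]/(L _) linear_tlift /=; rewrite (_ : tlift _ t = tlift (fun _ _ => 0 : K^o) t).
  by rewrite /tlift big1 // => i _; rewrite big1 // => j _; rewrite scaler0.
apply: eq_tlift => u v; rewrite fconstM.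
by apply: etrans (congr1 (fun z => z * _) (fconst_P1_free u)) (mul0r _).
Qed.

Definition relation_ideal : ideal (freealg K n) :=
  Ideal (ideal_gen_pred_closed relation) relation_ideal_proper.

Definition P_lambda : algType K := quot_alg relation_ideal.

(* The component of degree d is the image of that of the free algebra. *)
Definition P_lambda_homog (d : nat) (a : P_lambda) : Prop :=
  exists2 f : freealg K n, fhomog d f & a = qpi relation_ideal f.

Definition P_lambda_gen (v : 'rV[K]_n) : P_lambda := qpi relation_ideal (P1_free v).

End QuadraticDeformation.

(* Main.v *)
(* Since the action preserves degree, P_1 is an H-submodule of P, and its action
   extends to the free algebra on P_1 by h.(vf) = (h_1.v)(h_2.f). Because H acts
   compatibly with both the product and the bracket, sigma_lambda is H-linear, so
   its kernel R_lambda is stable and the action descends to P_lambda.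
   The relations have degree 2, so P_1 embeds in P_lambda: a Hopf ideal that kills
   P_lambda kills P_1, and then all of P, since P_1 generates P and
   Delta(I) lies in I (x) H + H (x) I. *)
Require Import Defs.
From HB Require Import structures.
From mathcomp Require Import all_boot fingroup all_algebra falgebra.
From mathcomp Require Import boolp.
(* Without its notations, which clash with those of mpoly. *)
From mathcomp Require Import -(notations) monalg.
From mathcomp Require Import mpoly.

Set Implicit Arguments.
Unset Strict Implicit.
Unset Printing Implicit Defensive.

Import GRing.Theory.
Local Open Scope ring_scope.

(** * Linear and bilinear maps, and evaluation of tensors *)

Section LinearMaps.
Variable K : fieldType.

(** Phrased for the bare predicate [linear], because operators such as [act h] come with a proof of
    linearity but no bundled structure. *)
Lemma linear_fun0 (U V : lmodType K) (L : U -> V) : linear L -> L 0 = 0.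
Proof.
move=> lL; pose M : {linear U -> V} := HB.pack L (GRing.isLinear.Build _ _ _ _ _ lL).
exact: (linear0 M).
Qed.

Lemma linear_funZ (U V : lmodType K) (L : U -> V) c u : linear L -> L (c *: u) = c *: L u.
Proof. by move=> lL; rewrite -[c *: u]addr0 lL linear_fun0 // addr0. Qed.

Lemma linear_fun_sum (U V : lmodType K) (L : U -> V) n (c : 'I_n -> K) (F : 'I_n -> U) :
  linear L -> L (\sum_i c i *: F i) = \sum_i c i *: L (F i).
Proof.
move=> lL; pose M : {linear U -> V} := HB.pack L (GRing.isLinear.Build _ _ _ _ _ lL).
by apply: etrans (linear_sum M _ _ _) _; apply: eq_bigr => i _; apply: linear_funZ.
Qed.

Lemma linear_closed_sum (V : lmodType K) (Q : V -> Prop) (I : Type) (r : seq I)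
    (c : I -> K) (F : I -> V) :
  Q 0 -> (forall a x y, Q x -> Q y -> Q (a *: x + y)) ->
  (forall i, Q (F i)) -> Q (\sum_(i <- r) c i *: F i).
Proof.
move=> Q0 QL QF; elim: r => [|i r IH]; first by rewrite big_nil.
by rewrite big_cons; apply: QL.
Qed.

Lemma linear_comp (U V W : lmodType K) (L : V -> W) (M : U -> V) :
  linear L -> linear M -> linear (fun u => L (M u)).
Proof. by move=> lL lM c x y; rewrite lM lL. Qed.

Lemma bilin_comp (U U' V V' W : lmodType K) (f : U' -> V' -> W) (L : U -> U') (M : V -> V') :
  bilin f -> linear L -> linear M -> bilin (fun u v => f (L u) (M v)).
Proof.
move=> [fl fr] lL lM; split=> [v c x y|u c x y].
  by rewrite /= lL (fl _).
by rewrite /= lM (fr _).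
Qed.

Lemma mul_bilin (A : algType K) : bilin (@GRing.mul A).
Proof.
by split=> [v c x y|u c x y]; rewrite ?mulrDl ?mulrDr -?scalerAl -?scalerAr.
Qed.

Section Tlift.
Variables (U V : vectType K).

Lemma linear_fun_tlift (W X : lmodType K) (L : W -> X) (f : U -> V -> W) t :
  linear L -> L (tlift f t) = tlift (fun u v => L (f u v)) t.
Proof.
move=> lL; pose M : {linear W -> X} := HB.pack L (GRing.isLinear.Build _ _ _ _ _ lL).
exact: (linear_tlift M).
Qed.

(** Fubini for two finite coordinate sums. It matches iterated Sweedler sums whose order of
    summation differs. *)
Lemma tlift_exchange (U' V' : vectType K) (W : lmodType K)
    (F : U -> V -> U' -> V' -> W) s t :
  tlift (fun u v => tlift (F u v) t) s =
  tlift (fun u' v' => tlift (fun u v => F u v u' v') s) t.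
Proof.
rewrite /tlift !pair_bigA.
under eq_bigr do rewrite pair_bigA scaler_sumr.
rewrite exchange_big; apply: eq_bigr => p _ /=.
rewrite pair_bigA scaler_sumr; apply: eq_bigr => q _ /=.
by rewrite !scalerA mulrC.
Qed.

Lemma linear_closed_tlift (W : lmodType K) (Q : W -> Prop) (f : U -> V -> W) t :
  Q 0 -> (forall a x y, Q x -> Q y -> Q (a *: x + y)) ->
  (forall u v, Q (f u v)) -> Q (tlift f t).
Proof.
by move=> Q0 QL Qf; rewrite /tlift pair_bigA; apply: linear_closed_sum.
Qed.

Lemma tlift_param_linear (X W : lmodType K) (F : X -> U -> V -> W) t :
  (forall u v, linear (fun x => F x u v)) -> linear (fun x => tlift (F x) t).
Proof. by move=> FL c x y; apply: tlift_comb => u v; rewrite FL. Qed.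

End Tlift.

(** * Sweedler calculus: the Hopf axioms applied under multilinear maps *)

Section Comul.
Variable H : fhopfType K.

(** A trilinear [T] factors through the left-bracketed triple tensor product, so the identity
    follows by applying the induced linear map to both sides of [comulA]. *)
Lemma sweedler_coassoc (W : lmodType K) (T : H -> H -> H -> W) h :
  (forall b c, linear (fun a => T a b c)) -> (forall a c, linear (fun b => T a b c)) ->
  (forall a b, linear (T a b)) ->
  tlift (fun a b => tlift (fun a1 a2 => T a1 a2 b) (comul a)) (comul h) =
  tlift (fun a b => tlift (T a) (comul b)) (comul h).
Proof.
move=> T1 T2 T3.
have bT c : bilin (fun a b => T a b c) by split=> ?; [exact: T1 | exact: T2].
(* [G] evaluates [T] on a tensor in its first two slots, which makes [tlift G] the linear map on
   triple tensors induced by [T]. *)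
pose G (t : tensor H H) c := tlift (fun a b => T a b c) t.
have bG : bilin G.
  split=> [c|t]; first exact: tlift_linear.
  by apply: tlift_param_linear => u v; apply: T3.
have lG := tlift_linear G; have := congr1 (tlift G) (comulA h).
rewrite !(linear_fun_tlift _ _ lG) => E.
have GT a b c : tlift G (tpure (tpure a b) c) = T a b c by rewrite tlift_pure // /G tlift_pure.
transitivity (tlift (fun a b => tlift G
    (tlift (fun a1 a2 => tpure (tpure a1 a2) b) (comul a))) (comul h)).
  apply: eq_tlift => a b; rewrite (linear_fun_tlift _ _ lG).
  by apply: eq_tlift => a1 a2; rewrite GT.
rewrite E; apply: eq_tlift => a b; rewrite (linear_fun_tlift _ _ lG).
by apply: eq_tlift => b1 b2; rewrite GT.
Qed.

Lemma sweedler_mul (W : lmodType K) (B : H -> H -> W) g h : bilin B ->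
  tlift B (comul (g * h)) =
  tlift (fun a b => tlift (fun c d => B (a * c) (b * d)) (comul h)) (comul g).
Proof.
move=> bB; rewrite comulM (linear_fun_tlift _ _ (tlift_linear B)).
apply: eq_tlift => a b; rewrite (linear_fun_tlift _ _ (tlift_linear B)).
by apply: eq_tlift => c d; rewrite tlift_pure.
Qed.

Lemma sweedler_counitl (W : lmodType K) (L : H -> W) h : linear L ->
  tlift (fun a b => counit a *: L b) (comul h) = L h.
Proof.
move=> lL; rewrite -[in RHS](counitl h) (linear_fun_tlift _ _ lL).
by apply: eq_tlift => a b; rewrite linear_funZ.
Qed.

Lemma sweedler_counitr (W : lmodType K) (L : H -> W) h : linear L ->
  tlift (fun a b => counit b *: L a) (comul h) = L h.
Proof.
move=> lL; rewrite -[in RHS](counitr h) (linear_fun_tlift _ _ lL).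
by apply: eq_tlift => a b; rewrite linear_funZ.
Qed.

End Comul.

(** Every element of [tensv A B] is a combination of pure tensors of basis vectors of [A] and [B],
    and [tlift f] kills each of these. *)
Lemma tlift_tensv_eq0 (U V : vectType K) (W : lmodType K) (f : U -> V -> W)
    (A : {vspace U}) (B : {vspace V}) t :
  bilin f -> (forall u v, u \in A -> v \in B -> f u v = 0) ->
  t \in tensv A B -> tlift f t = 0.
Proof.
rewrite /tensv => bf f0; set X := [seq _ | _ <- _, _ <- _].
move=> /(@coord_span _ _ _ (in_tuple X)) ->; rewrite linear_sum big1 // => i _; rewrite linearZ /=.
have /allpairsP[[u v] /= [uA vB ->]] := mem_nth 0 (ltn_ord i).
by rewrite tlift_pure // f0 ?vbasis_mem ?scaler0.
Qed.

End LinearMaps.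

(** * Hopf ideals that annihilate elements, and actions on quotient algebras *)

Section Actions.
Variables (K : fieldType) (H : fhopfType K).

(** Delta(h) splits into a part in I (x) H and a part in H (x) I; each vanishing hypothesis disposes
    of one part. *)
Lemma sweedler_hopf_ideal (I : hopf_ideal H) (W : lmodType K) (f : H -> H -> W) h :
  bilin f -> (forall a b, a \in hopf_ideal_vs I -> f a b = 0) ->
  (forall a b, b \in hopf_ideal_vs I -> f a b = 0) ->
  h \in hopf_ideal_vs I -> tlift f (comul h) = 0.
Proof.
move=> bf f1 f2 hI; have [_ /(_ h hI)/memv_addP[s sI [t tI ->]] _ _] := hopf_idealP I.
rewrite linearD /= (tlift_tensv_eq0 bf _ sI) ?(tlift_tensv_eq0 bf _ tI) ?addr0 //.
  by move=> u v _; apply: f2.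
by move=> u v uI _; apply: f1.
Qed.

(** The expression (h_1.a)(h_2.b) is bilinear in h_1 and h_2 and vanishes as soon as either lies in
    I. *)
Lemma hopf_action_annihM (A : algType K) (act : H -> A -> A) (I : hopf_ideal H) a b :
  hopf_action act -> (forall h, h \in hopf_ideal_vs I -> act h a = 0) ->
  (forall h, h \in hopf_ideal_vs I -> act h b = 0) ->
  forall h, h \in hopf_ideal_vs I -> act h (a * b) = 0.
Proof.
move=> [[actl actr] _ _ actM] a0 b0 h hI; rewrite actM.
apply: (sweedler_hopf_ideal _ _ _ hI) => [|x y xI|x y yI].
- by apply: bilin_comp => //; apply: mul_bilin.
- by rewrite a0 ?mul0r.
- by rewrite b0 ?mulr0.
Qed.

Section Quotient.
Variables (A : algType K) (act : H -> A -> A) (J : ideal A).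
Hypothesis act_hopf : hopf_action act.

(** Uses a chosen representative, so it makes sense before stability of [J] is assumed; independence
    of the choice is [quot_act_qpi]. *)
Definition quot_act (h : H) (q : quot_alg J) : quot_alg J :=
  qpi J (act h (generic_quotient.repr q)).

Hypothesis act_stable : forall h a, a \in ideal_pred J -> act h a \in ideal_pred J.

Lemma quot_act_qpi h a : quot_act h (qpi J a) = qpi J (act h a).
Proof.
have [[_ actr] _ _ _] := act_hopf.
pose L : {linear A -> A} := HB.pack (act h) (GRing.isLinear.Build _ _ _ _ _ (actr h)).
apply/eqP; rewrite qpi_eq -[act h _]/(L _) -[act h a]/(L _) -linearB.
by apply: act_stable; apply: repr_qpi.
Qed.

Lemma quot_act_hopf : hopf_action quot_act.
Proof.
have [[actl actr] [act1 actMl] act1r actMr] := act_hopf.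
split.
- split=> [|h c]; elim/quot_ind=> x; first by move=> c g h; rewrite !quot_act_qpi actl linearP.
  elim/quot_ind=> y; have := linearP (qpi J) c x y => /= <-.
  by rewrite !quot_act_qpi actr linearP.
- split=> [|g h]; elim/quot_ind=> x; first by rewrite quot_act_qpi act1.
  by rewrite !quot_act_qpi actMl.
- by move=> h; rewrite -(rmorph1 (qpi J)) quot_act_qpi act1r linearZ /=.
- move=> h; elim/quot_ind=> a; elim/quot_ind=> b.
  rewrite -rmorphM quot_act_qpi actMr (linear_tlift (qpi J)).
  by apply: eq_tlift => x y; rewrite rmorphM !quot_act_qpi.
Qed.

End Quotient.

(** The elements that all of H sends into the ideal generated by [S] form a two-sided ideal
    containing [S]; minimality of the generated ideal concludes. *)
Lemma ideal_gen_stable (A : algType K) (act : H -> A -> A) (S : A -> Prop) :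
  hopf_action act -> (forall h s, S s -> ideal_gen S (act h s)) ->
  forall h a, ideal_gen S a -> ideal_gen S (act h a).
Proof.
move=> [[_ actr] _ _ actM] actS h a aS.
have [I0 IB IM] := ideal_gen_closed S.
have IL c x y : ideal_gen S x -> ideal_gen S y -> ideal_gen S (c *: x + y).
  move=> xS yS; rewrite -[c *: x]opprK addrC; apply: IB => //.
  by rewrite -scaleNr -mulr_algl; have [] := IM (- c)%:A x xS.
have It f (t : tensor H H) : (forall u v, ideal_gen S (f u v)) -> ideal_gen S (tlift f t).
  exact: linear_closed_tlift.
(* The predicate quantifies over all [h], since in h.(bx) it is h_2 and not h that acts on x. *)
move: h; apply: (aS (fun x => forall h, ideal_gen S (act h x))) => [|s sS h]; last exact: actS.
split=> [h|x y xS yS h|b x xS].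
- by rewrite (linear_fun0 (actr h)).
- pose L : {linear A -> A} := HB.pack (act h) (GRing.isLinear.Build _ _ _ _ _ (actr h)).
  by rewrite -[act h _]/(L _) linearB; apply: IB; [apply: xS | apply: yS].
- by split=> h; rewrite actM; apply: It => u v; have [] := IM (act u b) (act v x) (xS v);
    have [] := IM (act v b) (act u x) (xS u).
Qed.

End Actions.

(** * Hopf actions determined by their values on generators *)

Section GeneratedAction.
Variables (K : fieldType) (H : fhopfType K) (A : algType K) (V : lmodType K).
Variables (iota : V -> A) (rho : H -> V -> V) (act : H -> A -> A).

(** Expresses that products of elements [iota v] span [A], in the form of an induction principle
    that multiplies by generators on the left. *)
Hypothesis A_gen : forall Q : A -> Prop, Q 1 ->
  (forall c x y, Q x -> Q y -> Q (c *: x + y)) ->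
  (forall v x, Q x -> Q (iota v * x)) -> forall x, Q x.
Hypothesis iotaL : linear iota.
Hypothesis rho_bilin : bilin rho.
Hypothesis rho1 : forall v, rho 1 v = v.
Hypothesis rhoM : forall g h v, rho (g * h) v = rho g (rho h v).
Hypothesis actr : forall h, linear (act h).
Hypothesis act1r : forall h, act h 1 = (counit h)%:A.
Hypothesis act_genM : forall h v x,
  act h (iota v * x) = tlift (fun a b => iota (rho a v) * act b x) (comul h).

Let iota_rhoL v : linear (fun h => iota (rho h v)).
Proof. exact: linear_comp iotaL (rho_bilin.1 v). Qed.

(** Linearity in h comes from that of the counit on 1, and from that of the comultiplication on
    [iota v * x]. *)
Lemma generated_act_bilin : bilin act.
Proof.
split=> // x c g h; elim/A_gen: x => [|d x y IHx IHy|v x IH] /=.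
- by rewrite !act1r counit_linear scalerDl scalerA.
- by rewrite !actr IHx IHy !scalerDr !scalerA [d * c]mulrC addrACA.
- by rewrite !act_genM comul_linear tlift_linear.
Qed.

Let actl x : linear (act^~ x). Proof. exact: generated_act_bilin.1. Qed.

(** The case x = 1 of [act_genM], collapsed by the counit axiom. *)
Lemma generated_act_gen h v : act h (iota v) = iota (rho h v).
Proof.
rewrite -[iota v]mulr1 act_genM -(sweedler_counitr _ (iota_rhoL v)).
by apply: eq_tlift => a b; rewrite act1r -scalerAr mulr1.
Qed.

(** Induction on x, for all h. For a product with a generator, both sides are (h_1.v)(h_2.x)(h_3.y)
    for the two bracketings of the iterated coproduct. *)
Lemma generated_actM h x y :
  act h (x * y) = tlift (fun a b => act a x * act b y) (comul h).
Proof.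
have [mull mulr] := mul_bilin A.
elim/A_gen: x h => [h|c x z IHx IHz h|v x IH h].
- rewrite mul1r -(sweedler_counitl _ (actl y)); apply: eq_tlift => a b.
  by rewrite act1r -scalerAl mul1r.
- rewrite mulrDl -scalerAl actr IHx IHz; symmetry; apply: tlift_comb => a b.
  by rewrite actr mulrDl -scalerAl.
pose T a b c := iota (rho a v) * (act b x * act c y).
transitivity (tlift (fun a b => tlift (T a) (comul b)) (comul h)).
  rewrite -mulrA act_genM; apply: eq_tlift => a b.
  by rewrite IH (linear_fun_tlift _ _ (mulr _)).
rewrite -sweedler_coassoc.
- apply: eq_tlift => a b; rewrite act_genM (linear_fun_tlift _ _ (mull (act b y))).
  by apply: eq_tlift => c d; rewrite /T mulrA.
- by move=> b c; apply: linear_comp (mull _) (iota_rhoL v).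
- by move=> a c; apply: linear_comp (mulr _) (linear_comp (mull _) (actl x)).
- by move=> a b; apply: linear_comp (mulr _) (linear_comp (mulr _) (actl y)).
Qed.

Lemma generated_act_hopf : hopf_action act.
Proof.
have genM_bilin v x : bilin (fun a b => iota (rho a v) * act b x).
  exact: bilin_comp (mul_bilin A) (iota_rhoL v) (actl x).
split; [exact: generated_act_bilin | | exact: act1r | exact: generated_actM].
split=> [x|g h x].
  elim/A_gen: x => [|c x y IHx IHy|v x IH].
  - by rewrite act1r counit1 scale1r.
  - by rewrite actr IHx IHy.
  - by rewrite act_genM comul1 tlift_pure // rho1 IH.
elim/A_gen: x g h => [g h|c x y IHx IHy g h|v x IH g h].
- rewrite !act1r counitM -[(counit h)%:A]addr0 actr (linear_fun0 (actr g)).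
  by rewrite addr0 act1r scalerA mulrC.
- by rewrite !actr IHx IHy.
rewrite !act_genM (sweedler_mul _ _ (genM_bilin _ _)) (linear_fun_tlift _ _ (actr g)).
(* Delta(gh) puts the sum over Delta(g) outside; on the other side g acts last, so its sum is
   inside. *)
rewrite tlift_exchange; apply: eq_tlift => a b.
rewrite generated_actM; apply: eq_tlift => c d.
by rewrite generated_act_gen IH rhoM.
Qed.

End GeneratedAction.

(** * Word basis, order filtration and grading of the free algebra *)

Section FreeAlgebra.
Variables (K : fieldType) (n : nat).
Local Notation F := (freealg K n).
Local Notation mcoeff := monalg.mcoeff.

(** The filtration by least word length. Its members are ideals, which serves to show that the
    relations, of order 2, impose nothing in degree 1. *)
Definition forder_ge (d : nat) (f : F) : Prop :=
  forall w : monalg.fmonom 'I_n, (monalg.fdeg w < d)%N -> mcoeff w f = 0.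

Definition fword (s : seq 'I_n) : F := monalg.mkmalgU (monalg.FMonom s) 1.

Lemma fword_nil : fword [::] = 1.
Proof.
by congr (monalg.mkmalgU _ 1); apply/eqP; rewrite monalg.fmP monalg.fm1.
Qed.

Lemma fword_cons i s : fword (i :: s) = fvar K i * fword s.
Proof.
rewrite /fword /fvar; etransitivity; last exact/esym/(monalg.fgmulUU (R := K)).
rewrite mulr1; congr (monalg.mkmalgU _ 1).
by rewrite -[RHS]/(monalg.fmmul _ _) monalg.fmmulE monalg.fmuE.
Qed.

Lemma freealg_span (Q : F -> Prop) :
  Q 0 -> (forall c f g, Q f -> Q g -> Q (c *: f + g)) ->
  (forall s, Q (fword s)) -> forall f, Q f.
Proof.
move=> Q0 QL Qw f; rewrite (monalg.monalgE f).
apply: (big_ind Q) => // [g h Qg Qh|w _]; first by have := QL 1 g h Qg Qh; rewrite scale1r.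
have -> : monalg.mkmalgU w (mcoeff w f) = mcoeff w f *: (monalg.mkmalgU w 1 : F) + 0.
  rewrite addr0; apply/monalg.malgP => v.
  by rewrite monalg.mcoeffZ !monalg.mcoeffU mulrnAr mulr1.
by apply: QL => //; rewrite -(monalg.fmK w); apply: Qw.
Qed.

Lemma linear_freealg_eq (W : lmodType K) (L M : F -> W) :
  linear L -> linear M -> (forall s, L (fword s) = M (fword s)) -> L =1 M.
Proof.
move=> lL lM eqLM; apply: freealg_span => //; first by rewrite !linear_fun0.
by move=> c f g LMf LMg; rewrite lL lM LMf LMg.
Qed.

Lemma freealg_ind (Q : F -> Prop) :
  Q 1 -> (forall c f g, Q f -> Q g -> Q (c *: f + g)) ->
  (forall i f, Q f -> Q (fvar K i * f)) -> forall f, Q f.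
Proof.
move=> Q1 QL QX.
have Q0 : Q 0 by have := QL (- 1) 1 1 Q1 Q1; rewrite scaleN1r addNr.
apply: freealg_span => //; elim=> [|i s IH]; first by rewrite fword_nil.
by rewrite fword_cons; apply: QX.
Qed.

(** Word length is additive, so only pairs whose lengths add up to that of [w] contribute. Asking
    for lengths alone covers both order and homogeneity. *)
Lemma mcoeffM_eq0 (f g : F) (w : monalg.fmonom 'I_n) :
  (forall u v : monalg.fmonom 'I_n, monalg.fdeg w = (monalg.fdeg u + monalg.fdeg v)%N ->
     mcoeff u f = 0 \/ mcoeff v g = 0) -> mcoeff w (f * g) = 0.
Proof.
move=> fg0; rewrite monalg.mcoeffMl big1 // => u _; rewrite big1 // => v _.
have [wE|_] := eqVneq; last exact: mulr0n.
rewrite -wE monalg.fdegM in fg0.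
by have [->|->] := fg0 u v erefl; rewrite ?mul0r ?mulr0 mul0rn.
Qed.

Lemma forder_geM d e f g : forder_ge d f -> forder_ge e g -> forder_ge (d + e) (f * g).
Proof.
move=> fd ge w wlt; apply: mcoeffM_eq0 => u v wE; rewrite wE in wlt.
have [ud|ud] := ltnP (monalg.fdeg u) d; [left; exact: fd | right; apply: ge].
by rewrite -(ltn_add2l d); apply: leq_ltn_trans wlt; rewrite leq_add2r.
Qed.

Lemma forder_ge_lin d c f g : forder_ge d f -> forder_ge d g -> forder_ge d (c *: f + g).
Proof. by move=> fd gd w wd; rewrite monalg.mcoeffD monalg.mcoeffZ fd ?gd ?mulr0 ?addr0. Qed.

Lemma forder_ge0 d : forder_ge d 0.
Proof. by move=> w _; rewrite monalg.mcoeff0. Qed.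

Lemma forder_ge_ideal d : is_ideal (forder_ge d).
Proof.
split=> [|f g fd gd|a f fd]; first exact: forder_ge0.
  by rewrite -scaleN1r addrC; apply: forder_ge_lin.
have a0 : forder_ge 0 a by [].
by split; [rewrite -[d]add0n | rewrite -[d]addn0]; apply: forder_geM.
Qed.

Lemma fhomogM d e (f g : F) : fhomog d f -> fhomog e g -> fhomog (d + e) (f * g).
Proof.
move=> fd ge w; apply: contraNeq => wE; apply/eqP/mcoeffM_eq0 => u v wuv.
have [fu|/fd ud] := eqVneq (mcoeff u f) 0; first by left.
have [gv|/ge ve] := eqVneq (mcoeff v g) 0; first by right.
by rewrite wuv ud ve eqxx in wE.
Qed.

Lemma fhomog_lin d c (f g : F) : fhomog d f -> fhomog d g -> fhomog d (c *: f + g).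
Proof.
move=> fd gd w; apply: contraNeq => wE; rewrite monalg.mcoeffD monalg.mcoeffZ.
have [->|/fd] := eqVneq (mcoeff w f) 0; last by move/eqP; rewrite (negPf wE).
have [->|/gd] := eqVneq (mcoeff w g) 0; last by move/eqP; rewrite (negPf wE).
by rewrite mulr0 addr0.
Qed.

Lemma fhomog0 d : fhomog d (0 : F).
Proof. by move=> w; rewrite monalg.mcoeff0 eqxx. Qed.

Lemma fhomog1 c : fhomog 0 (c *: (1 : F)).
Proof.
move=> w; rewrite monalg.mcoeffZ monalg.mcoeff1; have [->|_] := eqVneq w.
  by rewrite monalg.fdeg1.
by rewrite mulr0 eqxx.
Qed.

Lemma fhomog_var (i : 'I_n) : fhomog 1 (fvar K i).
Proof.
move=> w; rewrite /fvar monalg.mcoeffU; have [<-|_] := eqVneq _ w; first by rewrite monalg.fdegU.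
by rewrite eqxx.
Qed.

Lemma fhomog_forder_ge d f : fhomog d f -> forder_ge d f.
Proof. by move=> fd w wd; have [//|/fd E] := eqVneq (mcoeff w f) 0; rewrite E ltnn in wd. Qed.

Lemma fhomog_P1_free (v : 'rV[K]_n) : fhomog 1 (P1_free v).
Proof.
apply: linear_closed_sum => [|c f g|i]; [exact: fhomog0 | exact: fhomog_lin | exact: fhomog_var].
Qed.

Lemma P1_free_linear : linear (@P1_free K n).
Proof.
move=> c u v; rewrite /P1_free scaler_sumr -big_split; apply: eq_bigr => i _.
by rewrite !mxE scalerDl scalerA.
Qed.

Lemma mcoeff_P1_free (v : 'rV[K]_n) i : mcoeff (monalg.fmu i) (P1_free v) = v 0 i.
Proof.
rewrite /P1_free raddf_sum (bigD1 i) //= monalg.mcoeffZ monalg.mcoeffU eqxx mulr1.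
rewrite big1 ?addr0 // => j ji; rewrite monalg.mcoeffZ monalg.mcoeffU.
by rewrite monalg.fmP !monalg.fmU eqseq_cons (negPf ji) mulr0.
Qed.

Lemma P1_free_delta (i : 'I_n) : P1_free (delta_mx 0 i) = fvar K i.
Proof.
rewrite /P1_free (bigD1 i) //= mxE !eqxx scale1r big1 ?addr0 // => j /negPf ji.
by rewrite mxE ji andbF scale0r.
Qed.

Lemma P1_poly_linear : linear (@P1_poly K n).
Proof.
move=> c u v; rewrite /P1_poly scaler_sumr -big_split; apply: eq_bigr => i _.
by rewrite !mxE scalerDl scalerA.
Qed.

Lemma mcoeff_P1_poly (v : 'rV[K]_n) i : (P1_poly v)@_U_(i) = v 0 i.
Proof.
rewrite /P1_poly raddf_sum (bigD1 i) //= mcoeffZ mcoeffX eqxx mulr1.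
rewrite big1 ?addr0 // => j ji; rewrite mcoeffZ mcoeffX.
by rewrite eq_mnm1 (negPf ji) mulr0.
Qed.

Lemma P1_poly_inj : injective (@P1_poly K n).
Proof. by move=> u v uv; apply/rowP => i; rewrite -!mcoeff_P1_poly uv. Qed.

Lemma P1_poly_delta (i : 'I_n) : P1_poly (delta_mx 0 i) = 'X_i :> {mpoly K[n]}.
Proof.
rewrite /P1_poly (bigD1 i) //= mxE !eqxx scale1r big1 ?addr0 // => j /negPf ji.
by rewrite mxE ji andbF scale0r.
Qed.

Lemma P1_poly_homog (v : 'rV[K]_n) : P1_poly v \is 1.-homog.
Proof. by apply: rpred_sum => i _; apply: rpredZ; rewrite dhomogX /= mdeg1. Qed.

(** The monomials of degree 1 are the [U_(i)], and both sides have zero coefficient at all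
    others. *)
Lemma dhomog1_P1_poly (p : {mpoly K[n]}) :
  p \is 1.-homog -> p = P1_poly (\row_i p@_U_(i)).
Proof.
move=> ph; apply/mpolyP => m.
have [/mdeg1P[i /eqP ->]|m1] := boolP (mdeg m == 1%N); first by rewrite mcoeff_P1_poly mxE.
by rewrite !(dhomog_nemf_coeff _ m1) // P1_poly_homog.
Qed.

End FreeAlgebra.

(** * Extension of an action on P_1 to the free algebra *)

Section FreeAction.
Variables (K : fieldType) (n : nat) (H : fhopfType K).
Variable rho : H -> 'rV[K]_n -> 'rV[K]_n.
Local Notation F := (freealg K n).

Fixpoint word_act (h : H) (s : seq 'I_n) : F :=
  if s is i :: s' then
    tlift (fun a b => P1_free (rho a (delta_mx 0 i)) * word_act b s') (comul h)
  else (counit h)%:A.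

(** [mmap] serves here as linear extension from the basis of words; [word_act h] is not
    multiplicative in general. *)
Definition free_act (h : H) (f : F) : F :=
  monalg.mmap (in_alg F) (fun w : monalg.fmonom 'I_n => word_act h w) f.

Lemma free_act_word h s :
  free_act h (fword K s) = word_act h s.
Proof. by rewrite /free_act /fword monalg.mmapU /= scale1r mul1r. Qed.

Lemma free_act_linear h : linear (free_act h).
Proof.
move=> c f g; rewrite /free_act monalg.mmapD; congr (_ + _).
rewrite (monalg.mmapEw (monalg.msuppZ_le _ _)) monalg.mmapE scaler_sumr.
apply: eq_bigr => w _; rewrite monalg.mcoeffZ; apply: etrans (mulr_algl _ _) _.
by rewrite -scalerA; congr (_ *: _); apply/esym/mulr_algl.
Qed.

Lemma free_act1r h : free_act h 1 = (counit h)%:A.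
Proof.
exact: etrans (congr1 (free_act h) (esym (fword_nil K n))) (free_act_word h [::]).
Qed.

(** Both sides are linear in [f], and on words the identity is the recursion defining [word_act]. *)
Lemma free_act_varM h i f : free_act h (fvar K i * f) =
  tlift (fun a b => P1_free (rho a (delta_mx 0 i)) * free_act b f) (comul h).
Proof.
have [mull mulr] := mul_bilin F; move: f; apply: linear_freealg_eq => [||s].
- exact: linear_comp (free_act_linear h) (mulr _).
- by apply: tlift_param_linear => a b; apply: linear_comp (mulr _) (free_act_linear b).
- rewrite -fword_cons free_act_word; apply: eq_tlift => a b.
  by rewrite free_act_word.
Qed.

Hypothesis rho_bilin : bilin rho.
Hypothesis rho1 : forall v, rho 1 v = v.
Hypothesis rhoM : forall g h v, rho (g * h) v = rho g (rho h v).

(** Both sides are linear in [v], so the basis vectors suffice. This form does not refer to the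
    basis and is the one [generated_act_hopf] asks for. *)
Lemma free_act_P1M h v f : free_act h (P1_free v * f) =
  tlift (fun a b => P1_free (rho a v) * free_act b f) (comul h).
Proof.
have [mull _] := mul_bilin F.
pose L v := tlift (fun a b => P1_free (rho a v) * free_act b f) (comul h).
have LL : linear L.
  apply: tlift_param_linear => a b.
  exact: linear_comp (mull _) (linear_comp (@P1_free_linear K n) (rho_bilin.2 a)).
have LR : linear (fun v => free_act h (P1_free v * f)).
  exact: linear_comp (free_act_linear h) (linear_comp (mull f) (@P1_free_linear K n)).
rewrite -[RHS]/(L v) [in LHS](row_sum_delta v) [in RHS](row_sum_delta v).
rewrite (linear_fun_sum _ _ LL) [LHS](linear_fun_sum _ _ LR); apply: eq_bigr => i _.
by congr (_ *: _); rewrite P1_free_delta free_act_varM.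
Qed.

Lemma free_act_P1 h v : free_act h (P1_free v) = P1_free (rho h v).
Proof.
exact: (generated_act_gen (@P1_free_linear K n) rho_bilin free_act1r free_act_P1M).
Qed.

Lemma freealg_P1_ind (Q : F -> Prop) : Q 1 ->
  (forall c f g, Q f -> Q g -> Q (c *: f + g)) ->
  (forall v f, Q f -> Q (P1_free v * f)) -> forall f, Q f.
Proof.
move=> Q1 QL QX; apply: freealg_ind => // i f Qf.
by rewrite -P1_free_delta; apply: QX.
Qed.

Lemma free_act_hopf : hopf_action free_act.
Proof.
exact: (generated_act_hopf freealg_P1_ind (@P1_free_linear K n) rho_bilin rho1 rhoM
  free_act_linear free_act1r free_act_P1M).
Qed.

Lemma free_act_graded : graded_action (@fhomog K n) free_act.
Proof.
(* Each word is sent to a combination of words of the same length. *)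
have homog_word h s : fhomog (size s) (word_act h s).
  elim: s h => [|i s IH] h /=; first exact: fhomog1.
  apply: linear_closed_tlift => [|c f g|a b]; [exact: fhomog0 | exact: fhomog_lin |].
  by rewrite -add1n; apply: fhomogM; [apply: fhomog_P1_free | apply: IH].
move=> d h f fd; rewrite /free_act monalg.mmapE big_seq_cond.
apply: (big_ind (fhomog d)) => [|p q pd qd|w /andP[wf _]]; first exact: fhomog0.
  by rewrite -[p]scale1r; apply: fhomog_lin.
rewrite -(fd w) ?monalg.mcoeff_neq0 // /= (mulr_algl (monalg.mcoeff w f) (word_act h w)).
rewrite -[_ *: _]addr0.
by apply: fhomog_lin (homog_word h w) (fhomog0 _).
Qed.

End FreeAction.

(** * The action on P_1 and its control over the action on P *)

Section LinearPart.
Variables (K : fieldType) (n : nat) (H : fhopfType K).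
Variable act : H -> {mpoly K[n]} -> {mpoly K[n]}.
Hypothesis act_hopf : hopf_action act.
Hypothesis act_graded : graded_action (fun d (p : {mpoly K[n]}) => p \is d.-homog) act.

(** Only the degree 1 coefficients are kept; nothing is lost because the action is graded, see
    [P1_poly_act]. *)
Definition P1_act (h : H) (v : 'rV[K]_n) : 'rV[K]_n :=
  \row_i (act h (P1_poly v))@_U_(i).

Lemma P1_poly_act h v : P1_poly (P1_act h v) = act h (P1_poly v).
Proof. exact/esym/dhomog1_P1_poly/act_graded/P1_poly_homog. Qed.

Lemma P1_act_bilin : bilin P1_act.
Proof.
have [[actl actr] _ _ _] := act_hopf.
split=> [v c g h|h c u v]; apply: P1_poly_inj; rewrite P1_poly_linear !P1_poly_act.
  exact: actl.
by rewrite P1_poly_linear actr.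
Qed.

Lemma P1_act1 v : P1_act 1 v = v.
Proof. by have [_ [act1 _] _ _] := act_hopf; apply: P1_poly_inj; rewrite P1_poly_act act1. Qed.

Lemma P1_actM g h v : P1_act (g * h) v = P1_act g (P1_act h v).
Proof.
by have [_ [_ actM] _ _] := act_hopf; apply: P1_poly_inj; rewrite !P1_poly_act actM.
Qed.

(** The polynomials killed by I contain 1, as the counit vanishes on I, and the variables; they are
    closed under linear combinations, and under products by [hopf_action_annihM]. *)
Lemma annihilates_poly (I : hopf_ideal H) :
  (forall h v, h \in hopf_ideal_vs I -> P1_act h v = 0) ->
  forall h p, h \in hopf_ideal_vs I -> act h p = 0.
Proof.
have [[actl actr] _ act1r _] := act_hopf.
move=> I1 h p; move: p h.
have mul0 := hopf_action_annihM act_hopf (I := I).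
pose Q p := forall h, h \in hopf_ideal_vs I -> act h p = 0.
have Q1 : Q 1.
  by move=> h hI; rewrite act1r; have [_ _ -> //] := hopf_idealP I; rewrite scale0r.
suff QX m : Q 'X_[m].
  elim/mpolyind => [h _|c m p _ _ IH h hI]; first exact: linear_fun0 (actr h).
  by rewrite actr QX // IH // scaler0 addr0.
rewrite mpolyXE_id; apply: (big_ind Q) => // i _.
elim: (m i) => [|k IH]; first by rewrite expr0.
rewrite exprS; apply: mul0 => // h hI.
by rewrite -P1_poly_delta -P1_poly_act I1 // linear_fun0 //; apply: P1_poly_linear.
Qed.

End LinearPart.

(** * Descent of the free action to [P_lambda] *)

Section DeformedAction.
Variables (K : fieldType) (n : nat) (br : {mpoly K[n]} -> {mpoly K[n]} -> {mpoly K[n]}).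
Hypothesis br_bilin : bilin br.
Variable lambda : K.

Lemma sigma_bilin : bilin (sigma br lambda).
Proof.
have [brl brr] := br_bilin; have [mull mulr] := mul_bilin {mpoly K[n]}.
by split=> [q c p p'|p c q q']; rewrite /sigma ?(mull, brl) ?(mulr, brr);
  rewrite !scalerDr !scalerA [lambda * c]mulrC addrACA.
Qed.

Lemma P_lambda_gen_eq0 (v : 'rV[K]_n) : P_lambda_gen br lambda v = 0 -> v = 0.
Proof.
(* The relation ideal is tested against the ideal of elements of order at least 2, whose degree 1
   coefficients, here the coordinates of [v], are zero. *)
move/eqP; rewrite qpi_eq0 => /asboolP /(_ _ (@forder_ge_ideal K n 2%N)) v2.
apply/rowP => i; rewrite mxE -mcoeff_P1_free; apply: v2; last by rewrite monalg.fdegU.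
move=> _ [t _ ->]; apply: linear_closed_tlift => [|c f g|u w].
- exact: forder_ge0.
- exact: forder_ge_lin.
- by apply: (@forder_geM _ _ 1%N 1%N); apply/fhomog_forder_ge/fhomog_P1_free.
Qed.

Variables (H : fhopfType K) (act : H -> {mpoly K[n]} -> {mpoly K[n]}).
Hypothesis act_poisson : poisson_hopf_action br act.
Hypothesis act_graded : graded_action (fun d (p : {mpoly K[n]}) => p \is d.-homog) act.

Let act_hopf : hopf_action act. Proof. exact: act_poisson.1. Qed.

Local Notation rho := (P1_act act).
Let rho_bilin := P1_act_bilin act_hopf act_graded.
Let free_act_rho_hopf : hopf_action (free_act rho).
Proof.
exact: free_act_hopf rho_bilin (P1_act1 act_hopf act_graded) (P1_actM act_hopf act_graded).
Qed.

Lemma act_sigma h p q :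
  act h (sigma br lambda p q) =
  tlift (fun a b => sigma br lambda (act a p) (act b q)) (comul h).
Proof.
have [_ act_br] := act_poisson; have [[_ actr] _ _ actM] := act_hopf.
rewrite /sigma [in LHS]addrC actr actM act_br.
by symmetry; apply: tlift_comb => a b; rewrite addrC.
Qed.

Lemma relation_stable h r :
  relation br lambda r -> relation br lambda (free_act rho h r).
Proof.
have [[_ actr] _ _ _] := act_hopf; have [[_ fr] _ _ fM] := free_act_rho_hopf.
(* The witness is h.t for the diagonal action on P_1 (x) P_1. *)
move=> [t t0 ->]; exists (tlift (fun a b => tmap (rho a) (rho b) t) (comul h)).
  (* The target 0 is rewritten as h.sigma(t), which equals sigma(h.t) by [act_sigma]. *)
  rewrite -[RHS](linear_fun0 (actr h)) -t0 (linear_fun_tlift _ _ (actr h)).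
  rewrite (linear_fun_tlift _ _ (tlift_linear _)).
  under [RHS]eq_tlift do rewrite act_sigma.
  rewrite [RHS]tlift_exchange; apply: eq_tlift => a b.
  rewrite tlift_tmap; first by apply: eq_tlift => u v; rewrite !P1_poly_act.
  exact: bilin_comp sigma_bilin (@P1_poly_linear _ _) (@P1_poly_linear _ _).
(* Multiplication from P_1 (x) P_1 to the free algebra commutes with H in the same way. *)
rewrite (linear_fun_tlift _ _ (fr h)) (linear_fun_tlift _ _ (tlift_linear _)).
under [LHS]eq_tlift do rewrite fM.
rewrite [LHS]tlift_exchange; apply: eq_tlift => a b.
have P1M_bilin := bilin_comp (mul_bilin _) (@P1_free_linear K n) (@P1_free_linear K n).
apply/esym/(etrans (tlift_tmap _ _ _ P1M_bilin)); apply: eq_tlift => u v.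
by rewrite !(free_act_P1 rho_bilin).
Qed.

Definition P_lambda_act : H -> P_lambda br lambda -> P_lambda br lambda :=
  @quot_act _ _ _ (free_act rho) (relation_ideal br lambda).

Let free_act_stable h f :
  f \in ideal_gen_pred (relation br lambda) ->
  free_act rho h f \in ideal_gen_pred (relation br lambda).
Proof.
move=> /asboolP fI; apply/asboolP; apply: ideal_gen_stable fI => // g s sR J _ RJ.
exact/RJ/relation_stable.
Qed.

Lemma P_lambda_act_hopf : hopf_action P_lambda_act.
Proof. exact: quot_act_hopf. Qed.

Lemma P_lambda_act_graded : graded_action (@P_lambda_homog K n br lambda) P_lambda_act.
Proof.
move=> d h _ [f fd ->]; exists (free_act rho h f); first exact: free_act_graded.
exact: quot_act_qpi.
Qed.

Lemma P_lambda_act_gen h v :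
  P_lambda_act h (P_lambda_gen br lambda v) = P_lambda_gen br lambda (rho h v).
Proof. by rewrite /P_lambda_act quot_act_qpi // (free_act_P1 rho_bilin). Qed.

End DeformedAction.

(** * Induced actions, and transfer of the factorization from [P_lambda] to P *)

Theorem theorem3p6 (K : closedFieldType) (charK : [pchar K] =i pred0) (n : nat)
    (br : {mpoly K[n]} -> {mpoly K[n]} -> {mpoly K[n]})
    (br_poisson : poisson_bracket br) (br_quadratic : quadratic br)
    (H : fhopfType K) (act : H -> {mpoly K[n]} -> {mpoly K[n]})
    (act_poisson : poisson_hopf_action br act)
    (act_graded : graded_action (fun d (p : {mpoly K[n]}) => p \is d.-homog) act) :
  (forall lambda : K,
     exists act' : H -> P_lambda br lambda -> P_lambda br lambda,
       [/\ hopf_action act',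
           graded_action (@P_lambda_homog K n br lambda) act'
         & forall h (v w : 'rV[K]_n),
             act h (P1_poly v) = P1_poly w ->
             act' h (P_lambda_gen br lambda v) = P_lambda_gen br lambda w]) /\
  ((exists lambda : K,
      forall (H' : fhopfType K)
             (act' : H' -> P_lambda br lambda -> P_lambda br lambda),
        hopf_action act' ->
        graded_action (@P_lambda_homog K n br lambda) act' ->
        factors_through_group_algebra act') ->
   factors_through_group_algebra act).
Proof.
have [br_bilin _ _ _] := br_poisson; have [act_hopf _] := act_poisson.
split=> [lambda|[lambda factors]].
  exists (@P_lambda_act _ _ br lambda _ act); split.
  - exact: P_lambda_act_hopf.
  - exact: P_lambda_act_graded.
  - move=> h v w hvw; rewrite (P_lambda_act_gen br_bilin lambda act_poisson act_graded).
    (* [hvw] forces [w] to be [P1_act act h v], as P_1 embeds in P. *)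
    by congr P_lambda_gen; apply: P1_poly_inj; rewrite P1_poly_act.
(* The hypothesis is applied to H itself with the induced action. *)
have [I I0 IG] := factors H _ (P_lambda_act_hopf br_bilin lambda act_poisson act_graded)
  (P_lambda_act_graded br_bilin act_poisson act_graded).
(* The condition on H/I does not involve the algebra acted upon, so only annihilation of P, and
   hence of P_1, remains. *)
exists I => // h p hI; apply: (annihilates_poly act_hopf act_graded) hI => {}h v hI.
apply: (@P_lambda_gen_eq0 _ _ br lambda).
by rewrite -(P_lambda_act_gen br_bilin lambda act_poisson act_graded) I0.
Qed.
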